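(* Let $q:=\exp(2\pi i\tau)$ with $\tau$ in the upper half-plane $\mathcal H$. Let $\Delta(\tau):=q\prod_{r=1}^\infty(1-q^r)^{24}$ and, for $n\ge 2$, let $E_{2n}\equiv E_{2n}(q):=1-\frac{4n}{B_{2n}}\sum_{r=1}^\infty \frac{r^{2n-1}q^r}{1-q^r}$, where the Bernoulli numbers $B_n$ are defined by $\frac{t}{e^t-1}=\sum_{n\ge0}B_n\frac{t^n}{n!}$ for $|t|<2\pi$. Then, for $|q|<1$, $$E_4\Delta(\tau) = -\tfrac{691}{1728\cdot 250}\det\begin{vmatrix} E_4 & E_8\\ E_8 & E_{12}\end{vmatrix},$$ $$E_6\Delta(\tau) = \tfrac{691}{1728\cdot 250}\det\begin{vmatrix} E_4 & E_{12}\\ E_6 & E_{14}\end{vmatrix},$$ $$E_8\Delta(\tau) = \tfrac{3617}{1728\cdot 3\cdot 7^2\cdot 11}\det\begin{vmatrix} E_4 & E_{10}\\ E_{10} & E_{16}\end{vmatrix} = \tfrac{691}{1728\cdot 441}\det\begin{vmatrix} E_8 & E_{10}\\ E_{10} & E_{12}\end{vmatrix},$$ $$E_{10}\Delta(\tau) = \tfrac{691\cdot 43867}{1728\cdot 2\cdot 3^2\cdot 5^4\cdot 7^2\cdot 13}\det\begin{vmatrix} E_4 & E_{12}\\ E_{10} & E_{18}\end{vmatrix} = \tfrac{691}{1728\cdot 250}\det\begin{vmatrix} E_8 & E_{12}\\ E_{10} & E_{14}\end{vmatrix},$$ $$E_{14}\Delta(\tau) = \tfrac{691\cdot 593\cdot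 131}{1728\cdot 2\cdot 3\cdot 5^3\cdot 7^2\cdot 11\cdot 13}\det\begin{vmatrix} E_4 & E_{14}\\ E_{12} & E_{22}\end{vmatrix} = -\tfrac{691\cdot 3617}{1728\cdot 2\cdot 3\cdot 5^3\cdot 7^2\cdot 13}\det\begin{vmatrix} E_{10} & E_{14}\\ E_{12} & E_{16}\end{vmatrix},$$ $$E_4\Delta^2(\tau) = \tfrac{691^2}{(1728)^2\cdot (21)^2\cdot 250}\det\begin{vmatrix} E_4 & E_8 & E_{10}\\ E_6 & E_{10} & E_{12}\\ E_8 & E_{12} & E_{14}\end{vmatrix},$$ $$E_6\Delta^2(\tau) = -\tfrac{691^2}{(1728)^2\cdot (250)^2}\det\begin{vmatrix} E_6 & E_8 & E_{10}\\ E_8 & E_{10} & E_{12}\\ E_{10} & E_{12} & E_{14}\end{vmatrix},$$ $$E_8\Delta^2(\tau) = -\tfrac{(691)^2\cdot 3617}{(1728)^2\cdot 2^3\cdot 3\cdot 5^3\cdot 7^2\cdot 467}\det\begin{vmatrix} E_6 & E_8 & E_{12}\\ E_8 & E_{10} & E_{14}\\ E_{10} & E_{12} & E_{16}\end{vmatrix},$$ $$E_{10}\Delta^2(\tau) = \tfrac{(691)^2\cdot 3617}{(1728)^2\cdot 2^2\cdot 3\cdot 5^6\cdot 7^2\cdot 13}\det\begin{vmatrix} E_6 & E_{10} & E_{12}\\ E_8 & E_{12} & E_{14}\\ E_{10} & E_{14} & E_{16}\end{vmatrix},$$ $$E_{14}\Delta^2(\tau) = -\tfrac{(691)^2\cdot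 3617\cdot 43867}{(1728)^2\cdot 2^6\cdot 3\cdot 5^3\cdot 7^2\cdot 97\cdot 7213}\det\begin{vmatrix} E_8 & E_{10} & E_{14}\\ E_{10} & E_{12} & E_{16}\\ E_{12} & E_{14} & E_{18}\end{vmatrix},$$ $$E_4\Delta^3(\tau) = -\tfrac{(691)^3\cdot 3617}{(1728)^3\cdot 2^4\cdot 3\cdot 5^6\cdot 7^2\cdot 467}\det\begin{vmatrix} E_4 & E_6 & E_8 & E_{10}\\ E_6 & E_8 & E_{10} & E_{12}\\ E_8 & E_{10} & E_{12} & E_{14}\\ E_{10} & E_{12} & E_{14} & E_{16}\end{vmatrix},$$ $$E_6\Delta^3(\tau) = -\tfrac{(691)^3\cdot 43867}{(1728)^3\cdot 2^5\cdot 3^2\cdot 5^6\cdot 7^2\cdot 131}\det\begin{vmatrix} E_4 & E_6 & E_8 & E_{12}\\ E_6 & E_8 & E_{10} & E_{14}\\ E_8 & E_{10} & E_{12} & E_{16}\\ E_{10} & E_{12} & E_{14} & E_{18}\end{vmatrix},$$ $$E_8\Delta^3(\tau) = \tfrac{(691)^3\cdot (3617)^2}{(1728)^3\cdot 2^4\cdot 3^2\cdot 5^6\cdot 7^4\cdot 13\cdot 467}\det\begin{vmatrix} E_4 & E_6 & E_{10} & E_{12}\\ E_6 & E_8 & E_{12} & E_{14}\\ E_8 & E_{10} & E_{14} & E_{16}\\ E_{10} & E_{12} & E_{16} & E_{18}\end{vmatrix},$$ $$E_{10}\Delta^3(\tau) = -\tfrac{(691)^3\cdot 3617\cdot 43867}{(1728)^3\cdot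 2^7\cdot 3\cdot 5^6\cdot 7^2\cdot 97\cdot 7213}\det\begin{vmatrix} E_4 & E_8 & E_{10} & E_{12}\\ E_6 & E_{10} & E_{12} & E_{14}\\ E_8 & E_{12} & E_{14} & E_{16}\\ E_{10} & E_{14} & E_{16} & E_{18}\end{vmatrix},$$ $$E_{14}\Delta^3(\tau) = \tfrac{(691)^3\cdot (3617)^2\cdot 43867\cdot 283\cdot 617}{(1728)^4\cdot 2^3\cdot 3^2\cdot 5^6\cdot 7^2\cdot 31\cdot 3503110621}\det\begin{vmatrix} E_6 & E_8 & E_{10} & E_{14}\\ E_8 & E_{10} & E_{12} & E_{16}\\ E_{10} & E_{12} & E_{14} & E_{18}\\ E_{12} & E_{14} & E_{16} & E_{20}\end{vmatrix},$$ $$E_{14}\Delta^4(\tau) = \tfrac{(691)^4\cdot (3617)^2\cdot 43867\cdot 131\cdot 283\cdot 593\cdot 617}{(1728)^6\cdot 5^9\cdot 7^5\cdot 11\cdot 13\cdot 67\cdot 257\cdot 43721}\det\begin{vmatrix} E_4 & E_6 & E_8 & E_{10} & E_{14}\\ E_6 & E_8 & E_{10} & E_{12} & E_{16}\\ E_8 & E_{10} & E_{12} & E_{14} & E_{18}\\ E_{10} & E_{12} & E_{14} & E_{16} & E_{20}\\ E_{12} & E_{14} & E_{16} & E_{18} & E_{22}\end{vmatrix}.$$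
   Context: $q=\exp(2\pi i\tau)$, $\tau$ in the upper half-plane; $\Delta(\tau)=q\prod_{r\ge1}(1-q^r)^{24}$ is the modular discriminant; $E_{2n}(q)=1-\frac{4n}{B_{2n}}\sum_{r\ge1}\frac{r^{2n-1}q^r}{1-q^r}$ ($n\ge2$) are the classical Eisenstein series, with Bernoulli numbers $B_n$ given by $t/(e^t-1)=\sum B_n t^n/n!$. The determinants are minors of the Hankel determinants $\det(E_{2(i+j)}(q))_{1\le i,j\le m}$. *)

(* Defs.v *)
From HB Require Import structures.
From mathcomp Require Import all_boot all_order all_algebra.
From mathcomp Require Import all_classical all_reals all_analysis.
From mathcomp Require Import complex.

Set Implicit Arguments.
Unset Strict Implicit.
Unset Printing Implicit Defensive.

Import Order.TTheory GRing.Theory Num.Theory numFieldNormedType.Exports.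
Local Open Scope classical_set_scope.
Local Open Scope ring_scope.

(* The topology of the norm on R[i]: MathComp-Analysis has it for an abstract
   numFieldType, but it is not inferred for the constant [complex]. *)
HB.instance Definition _ (R : rcfType) := NormedModule.copy R[i] R[i]^o.

Definition expC (R : realType) (z : R[i]) : R[i] :=
  (expR (complex.Re z) * cos (complex.Im z) +i*
   (expR (complex.Re z) * sin (complex.Im z)))%C.

(* The condition determines [B]; at [t = 0] the quotient t / (e^t - 1) is only
   defined by its limit, so that point is left out. *)
Definition bernoulli_numbers (R : realType) (B : nat -> R[i]) : Prop :=
  forall t : R[i], t != 0 -> `|t| < (2 * pi)%:C%C ->
    series (fun n : nat => B n * t ^+ n / n`!%:R) @ \oo --> t / (expC t - 1).

Definition nome (R : realType) (tau : R[i]) : R[i] :=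
  expC (2 * pi%:C%C * 'i%C * tau).

Definition modular_discriminant (R : realType) (tau : R[i]) : R[i] :=
  let q := nome tau in
  q * limn (fun N : nat => \prod_(1 <= r < N.+1) (1 - q ^+ r) ^+ 24 : R[i]).

(* [eisenstein B q n] is E_{2n}(q), of weight 2n. *)
Definition eisenstein (R : realType) (B : nat -> R[i]) (q : R[i]) (n : nat)
    : R[i] :=
  1 - (4 * n)%:R / B (2 * n)%N *
      limn (fun N : nat => \sum_(1 <= r < N.+1)
              r%:R ^+ (2 * n - 1) * q ^+ r / (1 - q ^+ r) : R[i]).

(* The determinant of the square matrix with entries E_k, for [s] the list of
   its rows of indices k. *)
Definition index_det (R : realType) (E : nat -> R[i]) (s : seq (seq nat))
    : R[i] :=
  \det (\matrix_(i < size s, j < size s) E (nth 0%N (nth [::] s i) j)).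

(* Main.v *)
(* Every E_2k is 1 plus a multiple of the generating function of the divisor
   sum sigma_(2k-1).  Skoruppa's bijection between solutions of
   a x + b y = n turns each polynomial h(a, b) with the symmetries of
   a + b + c = 0 into a linear relation between the convolutions of the
   sigma_i and the sigma_i themselves.  Taking
   h = (a^2 + a b + b^2)^i (a b (a + b))^2 expresses E_8, ..., E_22 as
   polynomials in E_4 and E_6; taking h = (a^2 + a b + b^2)^2 and
   (a^2 + a b + b^2)^3 gives Ramanujan's equations for q dE_4/dq and
   q dE_6/dq.  By the latter, E_4^3 - E_6^2 and Delta have the same logarithmic
   derivative E_2, so E_4^3 - E_6^2 = 1728 Delta, and every determinant becomes
   an identity between polynomials in E_4 and E_6. *)
Require Import Defs.
From mathcomp Require Import all_boot all_order all_algebra.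
From mathcomp Require Import all_classical all_reals all_analysis.
From mathcomp Require Import complex.
From mathcomp Require Import ring lra zify.

Set Implicit Arguments.
Unset Strict Implicit.
Unset Printing Implicit Defensive.

Import Order.TTheory GRing.Theory Num.Theory numFieldNormedType.Exports.
Local Open Scope ring_scope.

(** * Minors of a table of indices *)

Section TableDet.
Variable F : comNzRingType.

(** The factor (a b (a + b))^2 has three effects. It vanishes for a = 0 and b = 0, which removes the
    boundary terms h(0, d), and for a + b = 0, which removes h(d, -d), the source of the derivative
    terms n sigma_k(n). It also makes the part of h that is odd in b a sum of monomials with both
    exponents odd and at least 3, so that sigma_1, hence the quasimodular E_2, never occurs and
    weights 8 to 22 stay among polynomials in E_4 and E_6. Powers of a^2 + a b + b^2 alone keep
    sigma_1 and the derivative, as Ramanujan's equations require. Identities between series are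
    proved coefficient by coefficient; analysis enters only to sum both sides for |q| < 1. The
    Bernoulli numbers, given through the sum of a series, are reached by comparing coefficients, and
    serve only to normalise each E_2n. The numerical constants (closed forms, relations, Bernoulli
    values) are supplied and then checked by [field] or [ring]. *)

Definition table_det (E : nat -> F) n (s : seq (seq nat)) : F :=
  \det (\matrix_(i < n, j < n) E (nth 0%N (nth [::] s i) j)).

Definition drop_nth T j (r : seq T) := take j r ++ drop j.+1 r.

Lemma nth_drop_nth T (x0 : T) j r k : nth x0 (drop_nth j r) k = nth x0 r (bump j k).
Proof.
rewrite nth_cat size_take_min /bump.
case: (leqP j k) => [jk|kj]; last first.
  have [kr|rk] := ltnP k (size r).
    by rewrite leq_min kj kr nth_take.
  rewrite ltnNge geq_min rk orbT /= nth_default ?[RHS]nth_default //.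
  by rewrite size_drop; lia.
rewrite ltnNge geq_min jk /= nth_drop.
have [rj|jr] := leqP (size r) j; first by rewrite !nth_default //; lia.
by congr nth; lia.
Qed.

Lemma table_det_expand E n r s :
  table_det E n.+1 (r :: s) =
  \sum_(j < n.+1) E (nth 0%N r j) * ((-1) ^+ j * table_det E n (map (drop_nth j) s)).
Proof.
rewrite /table_det (expand_det_row _ ord0); apply: eq_bigr => j _.
rewrite mxE /= /cofactor add0n; congr (_ * (_ * \det _)).
apply/matrixP => i k; rewrite !mxE /=; congr E.
case: (ltnP i (size s)) => h; first by rewrite (nth_map [::]) // nth_drop_nth.
by rewrite !(nth_default [::]) ?size_map // !nth_nil.
Qed.

Lemma table_det0 E s : table_det E 0 s = 1.
Proof. exact: det_mx00. Qed.

(** The sign is a boolean, so that evaluation leaves an explicit minus instead of powers of -1. *)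
Fixpoint alternating_sum (f : nat -> nat -> F) (j : nat) (sgn : bool) (r : seq nat) : F :=
  if r is k :: r' then
    (if sgn then - f j k else f j k) + alternating_sum f j.+1 (~~ sgn) r'
  else 0.

(** A form of the determinant that evaluates, on a concrete table of numerals, to an explicit
    polynomial in the values of [E]. *)
Fixpoint laplace (E : nat -> F) n (s : seq (seq nat)) : F :=
  if n is m.+1 then
    alternating_sum (fun j k => E k * laplace E m (map (drop_nth j) (behead s)))
      0 false (head [::] s)
  else 1.

Lemma alternating_sumE f j r : alternating_sum f j (odd j) r =
  \sum_(i < size r) (-1) ^+ (j + i) * f (j + i)%N (nth 0%N r i).
Proof.
elim: r j => [|k r IH] j; first by rewrite big_ord0.
rewrite big_ord_recl /= addn0 -[~~ odd j]/(odd j.+1) IH; congr (_ + _).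
  by rewrite -signr_odd; case: odd; rewrite ?expr1 ?expr0 ?mulN1r ?mul1r.
by apply: eq_bigr => i _; rewrite /bump /= add1n addnS addSn.
Qed.

Lemma table_detE E n s : size s = n -> all (fun r => size r == n) s ->
  table_det E n s = laplace E n s.
Proof.
elim: n s => [|n IH] [|r s] //=; first by rewrite table_det0.
move=> [sn] /andP[/eqP rn hs].
rewrite table_det_expand (alternating_sumE _ 0%N) rn; apply: eq_bigr => j _.
rewrite add0n mulrCA IH ?size_map // all_map; apply/allP => t /(allP hs) /= /eqP tn.
by rewrite size_cat size_take size_drop tn ltn_ord; have := ltn_ord j; lia.
Qed.
End TableDet.

(** * Convolutions of divisor sums *)

(** The guard makes the sum empty at n = 0, so sigma_k(0) = 0; constant terms of Eisenstein series
    are added separately. *)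
Definition divisor_sum (V : nmodType) (n : nat) (G : nat -> nat -> V) : V :=
  \sum_(d < n.+1 | (0 < n)%N && (d %| n)%N) G d (n %/ d)%N.

Definition sigma (F : pzSemiRingType) (k n : nat) : F :=
  divisor_sum n (fun d _ => d%:R ^+ k).

Definition conv (F : pzSemiRingType) (a b : nat -> F) (n : nat) : F :=
  \sum_(i < n.+1) a i * b (n - i)%N.

Section DivisorSums.
Variable V : nmodType.

(** The bound [N] is free so that divisor sums of different integers can share one index range. *)
Lemma divisor_sum_pairs n N (G : nat -> nat -> V) : (n <= N)%N ->
  divisor_sum n G =
  \sum_(d < N.+1) \sum_(x < N.+1 | [&& 0 < d, 0 < x & d * x == n]%N) G d x.
Proof.
move=> nN; have nN' : (n.+1 <= N.+1)%N by [].
rewrite /divisor_sum.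
rewrite (big_ord_widen_cond _ (fun d => (0 < n)%N && (d %| n)%N)
  (fun d => G d (n %/ d)%N) nN').
rewrite big_mkcond; apply: eq_bigr => d _.
case: ifP => [/andP[/andP[n0 dn] _]|dn].
  have d0 : (0 < d)%N by rewrite (dvdn_gt0 n0).
  have xN : (n %/ d < N.+1)%N by rewrite ltnS (leq_trans (leq_div _ _)).
  rewrite (big_pred1 (Ordinal xN)) // => x /=; rewrite d0 /=.
  apply/idP/eqP => [/andP[x0 /eqP e]|-> /=].
    by apply: val_inj; rewrite /= -e mulKn.
  by rewrite divn_gt0 // dvdn_leq //= mulnC divnK.
rewrite big_pred0 // => x; apply/negP => /and3P[d0 x0 /eqP e].
move: dn; rewrite -e dvdn_mulr // muln_gt0 d0 x0 /=.
by move/negP; apply; rewrite ltnS leq_pmulr.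
Qed.
End DivisorSums.

(** * Solutions of a x + b y = n in positive integers *)

Section Quadruples.
Variables (F : comPzRingType) (n : nat).

(** The layout is ((a, b), (x, y)) for a x + b y = n; positivity bounds all four by n, whence a
    finite type. *)
Definition quad := ('I_n.+1 * 'I_n.+1 * ('I_n.+1 * 'I_n.+1))%type.

Definition quadP (t : quad) : bool :=
  [&& 0 < t.1.1, 0 < t.1.2, 0 < t.2.1, 0 < t.2.2 &
      t.1.1 * t.2.1 + t.1.2 * t.2.2 == n]%N.

Definition quad_swap (t : quad) : quad := ((t.1.2, t.1.1), (t.2.2, t.2.1)).
Definition quad_dual (t : quad) : quad := (t.2, t.1).

Lemma sum_quad_swap (Q : pred quad) (G : quad -> F) :
  \sum_(t | quadP t && Q t) G t =
  \sum_(t | quadP t && Q (quad_swap t)) G (quad_swap t).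
Proof.
rewrite (reindex_inj (h := quad_swap)).
  apply: eq_bigl => -[[a b] [x y]]; rewrite /quadP /= addnC.
  by congr (_ && _); case: (0 < a)%N; case: (0 < b)%N; case: (0 < x)%N; case: (0 < y)%N.
by move=> [[a b] [x y]] [[a' b'] [x' y']] [-> -> -> ->].
Qed.

Lemma sum_quad_dual (Q : pred quad) (G : quad -> F) :
  \sum_(t | quadP t && Q t) G t =
  \sum_(t | quadP t && Q (quad_dual t)) G (quad_dual t).
Proof.
rewrite (reindex_inj (h := quad_dual)).
  apply: eq_bigl => -[[a b] [x y]]; rewrite /quadP /= mulnC [X in (_ + X)%N]mulnC.
  by congr (_ && _); case: (0 < a)%N; case: (0 < b)%N; case: (0 < x)%N; case: (0 < y)%N.
by move=> [[a b] [x y]] [[a' b'] [x' y']] [-> -> -> ->].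
Qed.

(* a x + b y = a (x - y) + (a + b) y *)
Lemma sum_quad_shear (G : nat -> nat -> F) :
  \sum_(t | quadP t && (t.2.2 < t.2.1)%N) G t.1.1 t.1.2 =
  \sum_(t | quadP t && (t.1.1 < t.1.2)%N) G t.1.1 (t.1.2 - t.1.1)%N.
Proof.
pose up (t : quad) : quad :=
  ((t.1.1, inord (t.1.2 - t.1.1)), (inord (t.2.1 + t.2.2), t.2.2)).
pose dn (t : quad) : quad :=
  ((t.1.1, inord (t.1.1 + t.1.2)), (inord (t.2.1 - t.2.2), t.2.2)).
have le_ab (a b x y : nat) : (0 < x -> 0 < y -> a * x + b * y = n -> a + b < n.+1)%N.
  by move=> x0 y0 <-; rewrite ltnS leq_add // leq_pmulr.
have shear (a b x y : nat) : (a < b -> a * (x + y) + (b - a) * y = a * x + b * y)%N.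
  by move=> ab; rewrite mulnDr mulnBl -addnA subnKC // leq_mul2r (ltnW ab) orbT.
rewrite (reindex_onto up dn) => [|[[a b] [x y]]] /=; last first.
  case/andP => /and5P[/= a0 b0 x0 y0 /eqP e] yx.
  have abn := le_ab _ _ _ _ x0 y0 e; have xn := ltn_ord x.
  rewrite /up /dn /=; congr ((_, _), (_, _)); apply: val_inj => /=.
    by rewrite inordK ?inordK //; lia.
  by rewrite inordK ?inordK //; lia.
apply: eq_big => [[[a b] [x y]]|[[a b] [x y]]] /=.
  have xn := ltn_ord x; have bn := ltn_ord b.
  have ba : (b - a < n.+1)%N by lia.
  rewrite /quadP /up /dn /= (inordK ba) subn_gt0.
  apply/idP/idP.
    case/andP => /andP[/and5P[a0 ab x0 y0 /eqP e] yx] /eqP[eb ex].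
    (* If x + y > n, [inord] returns its default 0, and y < 0 is impossible. *)
    have [xy|xy] := ltnP (x + y)%N n.+1; last first.
      by move: yx; rewrite /inord val_insubd; case: ifP => h; [lia|rewrite ltn0].
    move: e yx; rewrite inordK // => e yx.
    rewrite a0 y0 ab (ltn_trans a0 ab) /= andbT.
    have -> : (0 < x)%N by lia.
    by rewrite -shear // e /=.
  case/andP => /and5P[a0 b0 x0 y0 /eqP e] ab.
  have e' : (a * (x + y) + (b - a) * y = n)%N.
    by rewrite shear.
  have xy : (x + y < n.+1)%N.
    exact: leq_trans (leq_pmull _ a0) (leq_trans (leq_addr _ _) (eq_leq e')).
  rewrite inordK // a0 y0 ab addn_gt0 x0 e' eqxx /= -{1}[nat_of_ord y]add0n ltn_add2r x0 /=.
  by apply/eqP; congr ((_, _), (_, _)); apply: val_inj; rewrite /= ?inordK; lia.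
case/andP => /andP[/and5P[/= a0 b0 x0 y0 /eqP e] yx] _.
by rewrite inordK //; have := ltn_ord b; lia.
Qed.

(** For x = y the equation reads (a + b) x = n: the divisor is d = a + b, and a runs through 1, ...,
    d - 1. *)
Lemma sum_quad_diag (G : nat -> nat -> nat -> F) :
  \sum_(t | quadP t && (t.2.1 == t.2.2)) G t.1.1 t.1.2 t.2.1 =
  divisor_sum n (fun d x => \sum_(1 <= a < d) G a (d - a)%N x).
Proof.
rewrite (divisor_sum_pairs _ (leqnn n)).
pose T3 : finType := ('I_n.+1 * 'I_n.+1 * 'I_n.+1)%type.
pose P3 (s : T3) :=
  ([&& 0 < s.1.1, 0 < s.1.2 & s.1.1 * s.1.2 == n] && (0 < s.2 < s.1.1))%N.
transitivity (\sum_(s : T3 | P3 s) G s.2 (s.1.1 - s.2)%N s.1.2).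
  pose up (s : T3) : quad := ((s.2, inord (s.1.1 - s.2)), (s.1.2, s.1.2)).
  pose dn (t : quad) : T3 := ((inord (t.1.1 + t.1.2), t.2.1), t.1.1).
  rewrite (reindex_onto up dn) => [|[[a b] [x y]]] /=; last first.
    case/andP => /and5P[/= a0 b0 x0 y0 /eqP e] /eqP xy; rewrite /up /dn /=.
    have ab : (a + b < n.+1)%N.
      by rewrite ltnS; apply: leq_trans (eq_leq e); rewrite leq_add // leq_pmulr.
    congr ((_, _), (_, _)) => //; apply: val_inj => /=.
    by rewrite inordK ?inordK //; lia.
  apply: eq_big => [[[d x] a]|[[d x] a]] /=; rewrite /quadP /up /dn /=;
    have dn1 := ltn_ord d.
    have da : (d - a < n.+1)%N by lia.
    rewrite inordK // eqxx andbT -mulnDl /P3 /=.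
    have [ad|ad] := ltnP a d.
      rewrite subn_gt0 ad (leq_ltn_trans (leq0n a) ad) subnKC ?(ltnW ad) //=.
      have -> : inord d = d by apply: val_inj; rewrite /= inordK.
      by rewrite eqxx !andbT andbC; do 2!case: (0 < _)%N => //=; rewrite ?andbF ?andbT.
    by rewrite subn_gt0 (leq_gtF ad) /= !andbF.
  by case/andP => /andP[/and5P[a0 ad _ _ _] _] _; rewrite inordK //; lia.
rewrite (pair_big_dep (fun d : 'I_n.+1 => true)
  (fun d x : 'I_n.+1 => [&& 0 < d, 0 < x & d * x == n]%N)
  (fun d x => \sum_(1 <= a < d) G a (d - a)%N x)) /=.
rewrite (eq_bigr (fun p : 'I_n.+1 * 'I_n.+1 =>
  \sum_(a < n.+1 | (0 < a < p.1)%N) G a (p.1 - a)%N p.2)); last first.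
  move=> [d x] _ /=; have dn1 := ltn_ord d.
  rewrite (big_nat_widenl 1 0) // (big_nat_widen 0 d n.+1) ?(ltnW dn1) //.
  by rewrite big_mkord; apply: eq_bigl => a.
rewrite (pair_big_dep (fun p : 'I_n.+1 * 'I_n.+1 => [&& 0 < p.1, 0 < p.2 & p.1 * p.2 == n]%N)
  (fun (p : 'I_n.+1 * 'I_n.+1) (a : 'I_n.+1) => (0 < a < p.1)%N)
  (fun (p : 'I_n.+1 * 'I_n.+1) (a : 'I_n.+1) => G a (p.1 - a)%N p.2)) /=.
by apply: eq_bigl => -[[d x] a].
Qed.

(** The solutions are grouped by m = a x, which leaves the factorisations a x = m and b y = n - m to
    be chosen independently. *)
Lemma sum_quad_conv (f g : nat -> F) :
  \sum_(t | quadP t) f t.1.1 * g t.1.2 =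
  conv (fun m => divisor_sum m (fun d _ => f d))
       (fun m => divisor_sum m (fun d _ => g d)) n.
Proof.
rewrite (partition_big (fun t : quad => inord (t.1.1 * t.2.1) : 'I_n.+1) xpredT) //=.
apply: eq_bigr => m _.
have mn : (m <= n)%N by rewrite -ltnS.
rewrite (divisor_sum_pairs _ mn) (divisor_sum_pairs _ (leq_subr m n)).
rewrite !pair_big_dep /= big_distrlr /= pair_big_dep /=.
pose swp (t : ('I_n.+1 * 'I_n.+1) * ('I_n.+1 * 'I_n.+1)) : quad :=
  ((t.1.1, t.2.1), (t.1.2, t.2.2)).
rewrite (reindex swp); last first.
  by exists swp => -[[a b] [x y]].
apply: eq_bigl => -[[a x] [b y]]; rewrite /quadP /swp /=.
apply/idP/idP.
  case/andP => /and5P[a0 b0 x0 y0 /eqP e] /eqP em.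
  rewrite a0 b0 x0 y0 /=.
  have ax : (a * x < n.+1)%N by rewrite ltnS; apply: leq_trans (eq_leq e); exact: leq_addr.
  by rewrite -em /= inordK // eqxx /=; apply/eqP; lia.
case/andP => /and3P[a0 x0 /eqP ax] /and3P[b0 y0 /eqP bay].
rewrite a0 b0 x0 y0 /= ax; apply/andP; split; first by apply/eqP; lia.
by apply/eqP; apply: val_inj; rewrite /= inordK.
Qed.

End Quadruples.

(* Cutting the solutions of [a x + b y = n] according to the order of [x] and
   [y] and shearing turns them into the solutions with [a != b]; for an [h]
   invariant under the symmetries of [x + y + z = 0] the two sums of [h] then
   differ only by diagonal terms (Skoruppa). *)
Lemma skoruppa (F : comPzRingType) (h : F -> F -> F) (n : nat) :
    (forall x y, h x y = h y x) -> (forall x y, h (- x) (- y) = h x y) ->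
    (forall x y, h x (y - x) = h x (- y)) ->
  \sum_(t : quad n | quadP t) (h t.1.1%:R t.1.2%:R - h t.1.1%:R (- t.1.2%:R)) =
  divisor_sum n (fun d x => \sum_(1 <= a < d) h a%:R (d - a)%:R) -
  divisor_sum n (fun d x => (x%:R - 1) * h d%:R (- d%:R)).
Proof.
move=> hC hN hS.
have split3 (k : quad n -> nat) (l : quad n -> nat) (G : quad n -> F) :
  \sum_(t | quadP t) G t = \sum_(t | quadP t && (k t == l t)) G t +
   (\sum_(t | quadP t && (l t < k t)%N) G t + \sum_(t | quadP t && (k t < l t)%N) G t).
  rewrite (bigID (fun t => k t == l t)) /=; congr (_ + _).
  rewrite (bigID (fun t => (l t < k t)%N)) /=; congr (_ + _);
    apply: eq_bigl => t; rewrite -andbA; congr (_ && _); lia.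
rewrite sumrB [X in X - _](split3 (fun t => t.2.1 : nat) (fun t => t.2.2 : nat)).
rewrite [X in _ - X](split3 (fun t => t.1.1 : nat) (fun t => t.1.2 : nat)).
have e1 : \sum_(t : quad n | quadP t && (t.2.2 < t.2.1)%N) h t.1.1%:R t.1.2%:R =
          \sum_(t : quad n | quadP t && (t.1.1 < t.1.2)%N) h t.1.1%:R (- t.1.2%:R).
  rewrite (sum_quad_shear _ (fun a b => h a%:R b%:R)).
  by apply: eq_bigr => t /andP[_ ab]; rewrite natrB ?(ltnW ab) // hS.
have e2 : \sum_(t : quad n | quadP t && (t.2.1 < t.2.2)%N) h t.1.1%:R t.1.2%:R =
          \sum_(t : quad n | quadP t && (t.1.2 < t.1.1)%N) h t.1.1%:R (- t.1.2%:R).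
  rewrite sum_quad_swap /=.
  under eq_bigr do rewrite hC.
  rewrite e1 [RHS]sum_quad_swap /=; apply: eq_bigr => t _.
  by rewrite [RHS]hC -hN opprK.
rewrite e1 e2 [X in _ - (_ + X)]addrC opprD addrACA subrr addr0.
congr (_ - _).
  by rewrite (sum_quad_diag _ (fun a b _ => h a%:R b%:R)).
(* Duality exchanges the terms with a = b for those with x = y. There a divisor d splits in d - 1
   ways; renaming divisor and codivisor gives the factor x - 1. *)
rewrite sum_quad_dual /=.

transitivity (\sum_(t : quad n | quadP t && (t.2.1 == t.2.2)) h t.2.1%:R (- t.2.1%:R)).
  by apply: eq_big => [t|t /andP[_ /eqP /= ->]].
rewrite (sum_quad_diag _ (fun _ _ x => h x%:R (- x%:R))).
rewrite !(divisor_sum_pairs _ (leqnn n)) (exchange_big_dep xpredT) //=.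
apply: eq_bigr => d _; apply: eq_big => x; first by rewrite andbCA mulnC.
move=> /and3P[x0 _ _].
by rewrite sumr_const_nat -[_ *+ _]mulr_natl natrB.
Qed.

(** * Power sums over d, d - 2, ..., 2 - d *)

Section CentralSums.
Variable F : numFieldType.

(** Passing from d to d + 2 keeps the values d, d - 2, ..., 2 - d and adds d + 2 and -d; hence two
    initial values and a step of length 2. *)
Lemma sum_central (f Q : F -> F) :
    Q 0 = 0 -> Q 1 = f 1 -> (forall x, Q (x + 2) = Q x + f (x + 2) + f (- x)) ->
  forall d : nat, \sum_(a < d) f (d%:R - 2 * a%:R) = Q d%:R.
Proof.
move=> Q0 Q1 QS d; elim/ltn_ind: d => -[|[|d]] IH.
- by rewrite big_ord0.
- by rewrite big_ord1 mulr0 subr0 -Q1.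
rewrite big_ord_recl big_ord_recr /= -addn2 natrD QS -IH; last by lia.
rewrite mulr0 subr0 addrCA -[RHS]addrA; congr (_ + (_ + _)).
  by apply: eq_bigr => a _; congr f; rewrite /bump /= natrD; ring.
by congr f; rewrite /bump /= natrD; ring.
Qed.

Lemma sum_central_pow0 (d : nat) :
  \sum_(a < d) (d%:R - 2 * a%:R : F) ^+ 0 =
  d%:R.
Proof.
by apply: (sum_central (f := fun x => x ^+ 0)
  (Q := fun x => x)) => [||x]; field.
Qed.

(** For exponent 2k, this closed form and the following ones are 4^k (B(1 + d/2) + B(d/2)) / (2k +
    1), with B the Bernoulli polynomial of degree 2k + 1. *)
Lemma sum_central_pow2 (d : nat) :
  \sum_(a < d) (d%:R - 2 * a%:R : F) ^+ 2 =
  d%:R ^+ 3 / 3 + 2 / 3 * d%:R.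
Proof.
by apply: (sum_central (f := fun x => x ^+ 2)
  (Q := fun x => x ^+ 3 / 3 + 2 / 3 * x)) => [||x]; field.
Qed.

Lemma sum_central_pow4 (d : nat) :
  \sum_(a < d) (d%:R - 2 * a%:R : F) ^+ 4 =
  d%:R ^+ 5 / 5 + 4 / 3 * d%:R ^+ 3 - 8 / 15 * d%:R.
Proof.
by apply: (sum_central (f := fun x => x ^+ 4)
  (Q := fun x => x ^+ 5 / 5 + 4 / 3 * x ^+ 3 - 8 / 15 * x)) => [||x]; field.
Qed.

Lemma sum_central_pow6 (d : nat) :
  \sum_(a < d) (d%:R - 2 * a%:R : F) ^+ 6 =
  d%:R ^+ 7 / 7 + 2 * d%:R ^+ 5 - 8 / 3 * d%:R ^+ 3 + 32 / 21 * d%:R.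
Proof.
by apply: (sum_central (f := fun x => x ^+ 6)
  (Q := fun x => x ^+ 7 / 7 + 2 * x ^+ 5 - 8 / 3 * x ^+ 3 + 32 / 21 * x)) => [||x]; field.
Qed.

Lemma sum_central_pow8 (d : nat) :
  \sum_(a < d) (d%:R - 2 * a%:R : F) ^+ 8 =
  d%:R ^+ 9 / 9 + 8 / 3 * d%:R ^+ 7 - 112 / 15 * d%:R ^+ 5 + 128 / 9 * d%:R ^+ 3
    - 128 / 15 * d%:R.
Proof.
by apply: (sum_central (f := fun x => x ^+ 8)
  (Q := fun x => x ^+ 9 / 9 + 8 / 3 * x ^+ 7 - 112 / 15 * x ^+ 5 + 128 / 9 * x ^+ 3
    - 128 / 15 * x)) => [||x]; field.
Qed.

Lemma sum_central_pow10 (d : nat) :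
  \sum_(a < d) (d%:R - 2 * a%:R : F) ^+ 10 =
  d%:R ^+ 11 / 11 + 10 / 3 * d%:R ^+ 9 - 16 * d%:R ^+ 7 + 64 * d%:R ^+ 5
    - 128 * d%:R ^+ 3 + 2560 / 33 * d%:R.
Proof.
by apply: (sum_central (f := fun x => x ^+ 10)
  (Q := fun x => x ^+ 11 / 11 + 10 / 3 * x ^+ 9 - 16 * x ^+ 7 + 64 * x ^+ 5
    - 128 * x ^+ 3 + 2560 / 33 * x)) => [||x]; field.
Qed.

Lemma sum_central_pow12 (d : nat) :
  \sum_(a < d) (d%:R - 2 * a%:R : F) ^+ 12 =
  d%:R ^+ 13 / 13 + 4 * d%:R ^+ 11 - 88 / 3 * d%:R ^+ 9 + 1408 / 7 * d%:R ^+ 7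
    - 4224 / 5 * d%:R ^+ 5 + 5120%:R / 3 * d%:R ^+ 3 - 1415168%:R / 1365 * d%:R.
Proof.
by apply: (sum_central (f := fun x => x ^+ 12)
  (Q := fun x => x ^+ 13 / 13 + 4 * x ^+ 11 - 88 / 3 * x ^+ 9 + 1408 / 7 * x ^+ 7
    - 4224 / 5 * x ^+ 5 + 5120%:R / 3 * x ^+ 3 - 1415168%:R / 1365 * x)) => [||x]; field.
Qed.

Lemma sum_central_pow14 (d : nat) :
  \sum_(a < d) (d%:R - 2 * a%:R : F) ^+ 14 =
  d%:R ^+ 15 / 15 + 14 / 3 * d%:R ^+ 13 - 728 / 15 * d%:R ^+ 11
    + 4576 / 9 * d%:R ^+ 9 - 18304%:R / 5 * d%:R ^+ 7 + 46592%:R / 3 * d%:R ^+ 5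
    - 1415168%:R / 45 * d%:R ^+ 3 + 57344%:R / 3 * d%:R.
Proof.
by apply: (sum_central (f := fun x => x ^+ 14)
  (Q := fun x => x ^+ 15 / 15 + 14 / 3 * x ^+ 13 - 728 / 15 * x ^+ 11
    + 4576 / 9 * x ^+ 9 - 18304%:R / 5 * x ^+ 7 + 46592%:R / 3 * x ^+ 5
    - 1415168%:R / 45 * x ^+ 3 + 57344%:R / 3 * x)) => [||x]; field.
Qed.

Lemma sum_central_pow16 (d : nat) :
  \sum_(a < d) (d%:R - 2 * a%:R : F) ^+ 16 =
  d%:R ^+ 17 / 17 + 16 / 3 * d%:R ^+ 15 - 224 / 3 * d%:R ^+ 13
    + 3328 / 3 * d%:R ^+ 11 - 36608%:R / 3 * d%:R ^+ 9 + 266240%:R / 3 * d%:R ^+ 7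
    - 5660672%:R / 15 * d%:R ^+ 5 + 2293760%:R / 3 * d%:R ^+ 3
    - 118521856%:R / 255 * d%:R.
Proof.
by apply: (sum_central (f := fun x => x ^+ 16)
  (Q := fun x => x ^+ 17 / 17 + 16 / 3 * x ^+ 15 - 224 / 3 * x ^+ 13
    + 3328 / 3 * x ^+ 11 - 36608%:R / 3 * x ^+ 9 + 266240%:R / 3 * x ^+ 7
    - 5660672%:R / 15 * x ^+ 5 + 2293760%:R / 3 * x ^+ 3 - 118521856%:R / 255 * x)) => [||x]; field.
Qed.

Lemma sum_central_pow18 (d : nat) :
  \sum_(a < d) (d%:R - 2 * a%:R : F) ^+ 18 =
  d%:R ^+ 19 / 19 + 6 * d%:R ^+ 17 - 544 / 5 * d%:R ^+ 15 + 2176 * d%:R ^+ 13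
    - 169728%:R / 5 * d%:R ^+ 11 + 1131520%:R / 3 * d%:R ^+ 9
    - 96231424%:R / 35 * d%:R ^+ 7 + 11698176%:R * d%:R ^+ 5
    - 118521856%:R / 5 * d%:R ^+ 3 + 5749735424%:R / 399 * d%:R.
Proof.
by apply: (sum_central (f := fun x => x ^+ 18)
  (Q := fun x => x ^+ 19 / 19 + 6 * x ^+ 17 - 544 / 5 * x ^+ 15 + 2176 * x ^+ 13
    - 169728%:R / 5 * x ^+ 11 + 1131520%:R / 3 * x ^+ 9 - 96231424%:R / 35 * x ^+ 7
    + 11698176%:R * x ^+ 5 - 118521856%:R / 5 * x ^+ 3 + 5749735424%:R / 399 * x)) => [||x]; field.
Qed.

End CentralSums.

(** * Linear relations between convolutions of divisor sums *)

Section Relations.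
Variable F : numFieldType.
Implicit Types (i j m n d : nat) (x y : F).

Lemma sum_ordD d (f g : 'I_d -> F) :
  \sum_(a < d) (f a + g a) = \sum_(a < d) f a + \sum_(a < d) g a.
Proof. exact: big_split. Qed.

(** With z = -x - y the two bases are -(xy + yz + zx) and -xyz, symmetric in x, y, z. The second
    changes sign under negation, hence its even exponent. *)
Definition hform i j x y : F :=
  (x ^+ 2 + x * y + y ^+ 2) ^+ i * (x * y * (x + y)) ^+ (2 * j).

Lemma hformC i j x y : hform i j x y = hform i j y x.
Proof. by rewrite /hform; congr (_ ^+ _ * _ ^+ _); ring. Qed.

Lemma hformN i j x y : hform i j (- x) (- y) = hform i j x y.
Proof. by rewrite /hform !exprM; congr (_ ^+ _ * _ ^+ _); ring. Qed.

Lemma hformB i j x y : hform i j x (y - x) = hform i j x (- y).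
Proof. by rewrite /hform; congr (_ ^+ _ * _ ^+ _); ring. Qed.

(* With v = (d - 2 a)^2, the forms at (a, d - a) are polynomials in d and v:
   a^2 + a (d - a) + (d - a)^2 = (3 d^2 + v) / 4, a (d - a) = (d^2 - v) / 4. *)
Lemma hform_diag i j d (D := d%:R : F) : (0 < d)%N ->
  \sum_(1 <= a < d) hform i j a%:R (d - a)%:R =
  (\sum_(a < d) (3 * D ^+ 2 + (D - 2 * a%:R) ^+ 2) ^+ i *
     (D * (D ^+ 2 - (D - 2 * a%:R) ^+ 2)) ^+ (2 * j)) / 4 ^+ (i + 2 * j) -
  hform i j 0 D.
Proof.
move=> d0; apply: (addrI (hform i j 0 D)); rewrite [RHS]addrC subrK.
transitivity (\sum_(0 <= a < d) hform i j a%:R (d - a)%:R).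
  by rewrite [RHS]big_ltn // subn0.
rewrite big_mkord mulr_suml; apply: eq_bigr => a _.
rewrite natrB ?(ltnW (ltn_ord a)) // -/D /hform exprD invfM mulrACA -!expr_div_n.
by congr (_ ^+ _ * _ ^+ _); field.
Qed.

(** [O], [H] and [c] record the difference of [hform] at (a, b) and (a, -b), its diagonal sum, and
    its value on x + y = 0. With n = d x, the weight (x - 1) d^(m+1) becomes n d^m - d^(m+1), which
    produces the last two divisor sums. *)
Lemma conv_relation i j (O : seq (F * (nat * nat))) (H : seq (F * nat)) c m n :
    (forall a b, hform i j a b - hform i j a (- b) =
      \sum_(t <- O) t.1 * (a ^+ t.2.1 * b ^+ t.2.2)) ->
    (forall d, (0 < d)%N -> \sum_(1 <= a < d) hform i j a%:R (d - a)%:R =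
      \sum_(t <- H) t.1 * d%:R ^+ t.2) ->
    (forall x, hform i j x (- x) = c * x ^+ m.+1) ->
  \sum_(t <- O) t.1 * conv (sigma F t.2.1) (sigma F t.2.2) n =
  \sum_(t <- H) t.1 * sigma F t.2 n - c * (n%:R * sigma F m n - sigma F m.+1 n).
Proof.
move=> hO hH hc.
have := skoruppa n (hformC i j) (hformN i j) (hformB i j).
under eq_bigr do rewrite hO.
rewrite exchange_big /=.
under eq_bigr do rewrite -mulr_sumr
  (sum_quad_conv n (fun a => a%:R ^+ _) (fun a => a%:R ^+ _)).
move=> ->; congr (_ - _).
  under [RHS]eq_bigr do rewrite /sigma /divisor_sum mulr_sumr.
  rewrite exchange_big /=; apply: eq_bigr => d /andP[n0 dn].
  by rewrite hH // (dvdn_gt0 n0).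
rewrite /sigma /divisor_sum mulrBr !mulr_sumr -sumrB; apply: eq_bigr => d /andP[n0 dn].
have -> : n%:R = (n %/ d)%:R * d%:R :> F by rewrite -natrM divnK.
by rewrite hc exprS; ring.
Qed.

(** The difference is 4 a b (a^2 + b^2), whence sigma_1. The coefficient -1 at exponent 4 is the
    boundary term -h(0, d); it cancels [sigma F 4 n], which comes from h(d, -d) = d^4, and the
    derivative n sigma_3(n) remains. *)
Lemma conv_sigma1_weight6 n :
  \sum_(t <- [:: (4, (1, 3)%N); (4, (3, 1)%N)])
    t.1 * conv (sigma F t.2.1) (sigma F t.2.2) n =
  \sum_(t <- [:: (7 / 10, 5%N); (- 1, 4%N); (1 / 3, 3%N); (- 1 / 30, 1%N)])
    t.1 * sigma F t.2 n -
  (n%:R * sigma F 3 n - sigma F 4 n).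
Proof.
rewrite (@conv_relation 2 0 _
  [:: (7 / 10, 5%N); (- 1, 4%N); (1 / 3, 3%N); (- 1 / 30, 1%N)] 1 3).
- by rewrite [X in _ - X = _]mul1r.
- by move=> a b; rewrite /hform !big_cons big_nil; cbn [fst snd]; ring.
- move=> d d0; rewrite hform_diag //.
  pose D : F := d%:R; pose v (a : 'I_d) k := (D - 2 * a%:R) ^+ (2 * k).
  rewrite (eq_bigr (fun a =>
    9 * D ^+ 4 * v a 0 + 6 * D ^+ 2 * v a 1 + v a 2)); last first.
    by move=> a _; rewrite /v /D; set w := _ - _; ring.
  rewrite !sum_ordD -!mulr_sumr sum_central_pow0 sum_central_pow2 sum_central_pow4.
  by rewrite !big_cons big_nil /hform /D; cbn [fst snd]; field.
- by move=> x; rewrite /hform; ring.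
Qed.

(** The convolution of sigma_3 with itself that appears here is eliminated later by
    [conv_sigma_weight8]. *)
Lemma conv_sigma1_weight8 n :
  \sum_(t <- [:: (6, (1, 5)%N); (14, (3, 3)%N); (6, (5, 1)%N)])
    t.1 * conv (sigma F t.2.1) (sigma F t.2.2) n =
  \sum_(t <- [:: (83 / 140, 7%N); (- 1, 6%N); (1 / 2, 5%N); (- 7 / 60, 3%N);
                (1 / 42, 1%N)])
    t.1 * sigma F t.2 n -
  (n%:R * sigma F 5 n - sigma F 6 n).
Proof.
rewrite (@conv_relation 3 0 _
  [:: (83 / 140, 7%N); (- 1, 6%N); (1 / 2, 5%N); (- 7 / 60, 3%N);
      (1 / 42, 1%N)] 1 5).
- by rewrite [X in _ - X = _]mul1r.
- by move=> a b; rewrite /hform !big_cons big_nil; cbn [fst snd]; ring.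
- move=> d d0; rewrite hform_diag //.
  pose D : F := d%:R; pose v (a : 'I_d) k := (D - 2 * a%:R) ^+ (2 * k).
  rewrite (eq_bigr (fun a =>
    27 * D ^+ 6 * v a 0 + 27 * D ^+ 4 * v a 1 + 9 * D ^+ 2 * v a 2 + v a 3)); last first.
    by move=> a _; rewrite /v /D; set w := _ - _; ring.
  rewrite !sum_ordD -!mulr_sumr sum_central_pow0 sum_central_pow2 sum_central_pow4
    sum_central_pow6.
  by rewrite !big_cons big_nil /hform /D; cbn [fst snd]; field.
- by move=> x; rewrite /hform; ring.
Qed.

(** The part of (a b (a + b))^2 that is odd in b is 2 a^3 b^3, counted twice in the difference. In
    terms of series this is E_4^2 = E_8. *)
Lemma conv_sigma_weight8 n :
  \sum_(t <- [:: (4, (3, 3)%N)])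
    t.1 * conv (sigma F t.2.1) (sigma F t.2.2) n =
  \sum_(t <- [:: (1 / 30, 7%N); (- 1 / 30, 3%N)])
    t.1 * sigma F t.2 n.
Proof.
rewrite (@conv_relation 0 1 _
  [:: (1 / 30, 7%N); (- 1 / 30, 3%N)] 0 0).
- by rewrite [X in _ - X = _]mul0r subr0.
- by move=> a b; rewrite /hform !big_cons big_nil; cbn [fst snd]; ring.
- move=> d d0; rewrite hform_diag //.
  pose D : F := d%:R; pose v (a : 'I_d) k := (D - 2 * a%:R) ^+ (2 * k).
  (* The integers, here and in the higher weights, are the coefficients of (3 D^2 + v)^i D^2 (D^2 -
     v)^2 as a polynomial in v. *)
  rewrite (eq_bigr (fun a =>
    D ^+ 6 * v a 0 + (- 2) * D ^+ 4 * v a 1 + D ^+ 2 * v a 2)); last first.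
    by move=> a _; rewrite /v /D; set w := _ - _; ring.
  rewrite !sum_ordD -!mulr_sumr sum_central_pow0 sum_central_pow2 sum_central_pow4.
  by rewrite !big_cons big_nil /hform /D; cbn [fst snd]; field.
- by move=> x; rewrite /hform; ring.
Qed.

(** Put G_k = -B_k/(2k) + sum_n sigma_(k-1)(n) q^n. From here on each relation says that a
    combination of products G_r G_s is a multiple of G_(r+s): the lower coefficients on the right,
    such as B_(k-4) at sigma_3 in weight k, are the cross terms with the constants -B_r/(2r). *)
Lemma conv_sigma_weight10 n :
  \sum_(t <- [:: (6, (3, 5)%N); (6, (5, 3)%N)])
    t.1 * conv (sigma F t.2.1) (sigma F t.2.2) n =
  \sum_(t <- [:: (11 / 420, 9%N); (- 1 / 20, 5%N); (1 / 42, 3%N)])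
    t.1 * sigma F t.2 n.
Proof.
rewrite (@conv_relation 1 1 _
  [:: (11 / 420, 9%N); (- 1 / 20, 5%N); (1 / 42, 3%N)] 0 0).
- by rewrite [X in _ - X = _]mul0r subr0.
- by move=> a b; rewrite /hform !big_cons big_nil; cbn [fst snd]; ring.
- move=> d d0; rewrite hform_diag //.
  pose D : F := d%:R; pose v (a : 'I_d) k := (D - 2 * a%:R) ^+ (2 * k).
  rewrite (eq_bigr (fun a =>
    3 * D ^+ 8 * v a 0 + (- 5) * D ^+ 6 * v a 1 + D ^+ 4 * v a 2
    + D ^+ 2 * v a 3)); last first.
    by move=> a _; rewrite /v /D; set w := _ - _; ring.
  rewrite !sum_ordD -!mulr_sumr sum_central_pow0 sum_central_pow2 sum_central_pow4
    sum_central_pow6.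
  by rewrite !big_cons big_nil /hform /D; cbn [fst snd]; field.
- by move=> x; rewrite /hform; ring.
Qed.

Lemma conv_sigma_weight12 n :
  \sum_(t <- [:: (8, (3, 7)%N); (20, (5, 5)%N); (8, (7, 3)%N)])
    t.1 * conv (sigma F t.2.1) (sigma F t.2.2) n =
  \sum_(t <- [:: (13 / 630, 11%N); (- 1 / 15, 7%N); (5 / 63, 5%N); (- 1 / 30, 3%N)])
    t.1 * sigma F t.2 n.
Proof.
rewrite (@conv_relation 2 1 _
  [:: (13 / 630, 11%N); (- 1 / 15, 7%N); (5 / 63, 5%N); (- 1 / 30, 3%N)] 0 0).
- by rewrite [X in _ - X = _]mul0r subr0.
- by move=> a b; rewrite /hform !big_cons big_nil; cbn [fst snd]; ring.
- move=> d d0; rewrite hform_diag //.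
  pose D : F := d%:R; pose v (a : 'I_d) k := (D - 2 * a%:R) ^+ (2 * k).
  rewrite (eq_bigr (fun a =>
    9 * D ^+ 10 * v a 0 + (- 12) * D ^+ 8 * v a 1 + (- 2) * D ^+ 6 * v a 2
    + 4 * D ^+ 4 * v a 3 + D ^+ 2 * v a 4)); last first.
    by move=> a _; rewrite /v /D; set w := _ - _; ring.
  rewrite !sum_ordD -!mulr_sumr sum_central_pow0 sum_central_pow2 sum_central_pow4
    sum_central_pow6 sum_central_pow8.
  by rewrite !big_cons big_nil /hform /D; cbn [fst snd]; field.
- by move=> x; rewrite /hform; ring.
Qed.

Lemma conv_sigma_weight14 n :
  \sum_(t <- [:: (10, (3, 9)%N); (44, (5, 7)%N); (44, (7, 5)%N); (10, (9, 3)%N)])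
    t.1 * conv (sigma F t.2.1) (sigma F t.2.2) n =
  \sum_(t <- [:: (113 / 6930%:R, 13%N); (- 1 / 12, 9%N); (11 / 63, 7%N);
                (- 11 / 60, 5%N); (5 / 66, 3%N)])
    t.1 * sigma F t.2 n.
Proof.
rewrite (@conv_relation 3 1 _
  [:: (113 / 6930%:R, 13%N); (- 1 / 12, 9%N); (11 / 63, 7%N);
      (- 11 / 60, 5%N); (5 / 66, 3%N)] 0 0).
- by rewrite [X in _ - X = _]mul0r subr0.
- by move=> a b; rewrite /hform !big_cons big_nil; cbn [fst snd]; ring.
- move=> d d0; rewrite hform_diag //.
  pose D : F := d%:R; pose v (a : 'I_d) k := (D - 2 * a%:R) ^+ (2 * k).
  rewrite (eq_bigr (fun a =>
    27 * D ^+ 12 * v a 0 + (- 27) * D ^+ 10 * v a 1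
    + (- 18) * D ^+ 8 * v a 2 + 10 * D ^+ 6 * v a 3 + 7 * D ^+ 4 * v a 4
    + D ^+ 2 * v a 5)); last first.
    by move=> a _; rewrite /v /D; set w := _ - _; ring.
  rewrite !sum_ordD -!mulr_sumr sum_central_pow0 sum_central_pow2 sum_central_pow4
    sum_central_pow6 sum_central_pow8 sum_central_pow10.
  by rewrite !big_cons big_nil /hform /D; cbn [fst snd]; field.
- by move=> x; rewrite /hform; ring.
Qed.

Lemma conv_sigma_weight16 n :
  \sum_(t <- [:: (12, (3, 11)%N); (80, (5, 9)%N); (140, (7, 7)%N); (80, (9, 5)%N);
                (12, (11, 3)%N)])
    t.1 * conv (sigma F t.2.1) (sigma F t.2.2) n =
  \sum_(t <- [:: (2329 / 180180%:R, 15%N); (- 1 / 10, 11%N); (20 / 63, 9%N);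
                (- 7 / 12, 7%N); (20 / 33, 5%N); (- 691 / 2730, 3%N)])
    t.1 * sigma F t.2 n.
Proof.
rewrite (@conv_relation 4 1 _
  [:: (2329 / 180180%:R, 15%N); (- 1 / 10, 11%N); (20 / 63, 9%N);
      (- 7 / 12, 7%N); (20 / 33, 5%N); (- 691 / 2730, 3%N)] 0 0).
- by rewrite [X in _ - X = _]mul0r subr0.
- by move=> a b; rewrite /hform !big_cons big_nil; cbn [fst snd]; ring.
- move=> d d0; rewrite hform_diag //.
  pose D : F := d%:R; pose v (a : 'I_d) k := (D - 2 * a%:R) ^+ (2 * k).
  rewrite (eq_bigr (fun a =>
    81 * D ^+ 14 * v a 0 + (- 54) * D ^+ 12 * v a 1
    + (- 81) * D ^+ 10 * v a 2 + 12 * D ^+ 8 * v a 3 + 31 * D ^+ 6 * v a 4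
    + 10 * D ^+ 4 * v a 5 + D ^+ 2 * v a 6)); last first.
    by move=> a _; rewrite /v /D; set w := _ - _; ring.
  rewrite !sum_ordD -!mulr_sumr sum_central_pow0 sum_central_pow2 sum_central_pow4
    sum_central_pow6 sum_central_pow8 sum_central_pow10 sum_central_pow12.
  by rewrite !big_cons big_nil /hform /D; cbn [fst snd]; field.
- by move=> x; rewrite /hform; ring.
Qed.

Lemma conv_sigma_weight18 n :
  \sum_(t <- [:: (14, (3, 13)%N); (130, (5, 11)%N); (342, (7, 9)%N); (342, (9, 7)%N);
                (130, (11, 5)%N); (14, (13, 3)%N)])
    t.1 * conv (sigma F t.2.1) (sigma F t.2.2) n =
  \sum_(t <- [:: (19 / 1848, 17%N); (- 7 / 60, 13%N); (65 / 126, 11%N);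
                (- 57 / 40, 9%N); (57 / 22, 7%N); (- 691 / 252, 5%N);
                (7 / 6, 3%N)])
    t.1 * sigma F t.2 n.
Proof.
rewrite (@conv_relation 5 1 _
  [:: (19 / 1848, 17%N); (- 7 / 60, 13%N); (65 / 126, 11%N);
      (- 57 / 40, 9%N); (57 / 22, 7%N); (- 691 / 252, 5%N); (7 / 6, 3%N)] 0 0).
- by rewrite [X in _ - X = _]mul0r subr0.
- by move=> a b; rewrite /hform !big_cons big_nil; cbn [fst snd]; ring.
- move=> d d0; rewrite hform_diag //.
  pose D : F := d%:R; pose v (a : 'I_d) k := (D - 2 * a%:R) ^+ (2 * k).
  rewrite (eq_bigr (fun a =>
    243 * D ^+ 16 * v a 0 + (- 81) * D ^+ 14 * v a 1
    + (- 297) * D ^+ 12 * v a 2 + (- 45) * D ^+ 10 * v a 3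
    + 105 * D ^+ 8 * v a 4 + 61 * D ^+ 6 * v a 5 + 13 * D ^+ 4 * v a 6
    + D ^+ 2 * v a 7)); last first.
    by move=> a _; rewrite /v /D; set w := _ - _; ring.
  rewrite !sum_ordD -!mulr_sumr sum_central_pow0 sum_central_pow2 sum_central_pow4
    sum_central_pow6 sum_central_pow8 sum_central_pow10 sum_central_pow12
    sum_central_pow14.
  by rewrite !big_cons big_nil /hform /D; cbn [fst snd]; field.
- by move=> x; rewrite /hform; ring.
Qed.

Lemma conv_sigma_weight20 n :
  \sum_(t <- [:: (16, (3, 15)%N); (196, (5, 13)%N); (712, (7, 11)%N); (1068, (9, 9)%N);
                (712, (11, 7)%N); (196, (13, 5)%N); (16, (15, 3)%N)])
    t.1 * conv (sigma F t.2.1) (sigma F t.2.2) n =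
  \sum_(t <- [:: (419 / 51051%:R, 19%N); (- 2 / 15, 15%N); (7 / 9, 13%N);
                (- 89 / 30, 11%N); (89 / 11, 9%N);
                (- 61499%:R / 4095, 7%N); (49 / 3, 5%N);
                (- 3617 / 510, 3%N)])
    t.1 * sigma F t.2 n.
Proof.
rewrite (@conv_relation 6 1 _
  [:: (419 / 51051%:R, 19%N); (- 2 / 15, 15%N); (7 / 9, 13%N);
      (- 89 / 30, 11%N); (89 / 11, 9%N); (- 61499%:R / 4095, 7%N);
      (49 / 3, 5%N); (- 3617 / 510, 3%N)] 0 0).
- by rewrite [X in _ - X = _]mul0r subr0.
- by move=> a b; rewrite /hform !big_cons big_nil; cbn [fst snd]; ring.
- move=> d d0; rewrite hform_diag //.
  pose D : F := d%:R; pose v (a : 'I_d) k := (D - 2 * a%:R) ^+ (2 * k).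
  (* The zero coefficient is kept so that the rewriting with [sum_central_pow2] below finds its
     sum. *)
  rewrite (eq_bigr (fun a =>
    729 * D ^+ 18 * v a 0 + 0 * D ^+ 16 * v a 1
    + (- 972) * D ^+ 14 * v a 2 + (- 432) * D ^+ 12 * v a 3
    + 270 * D ^+ 10 * v a 4 + 288 * D ^+ 8 * v a 5 + 100 * D ^+ 6 * v a 6
    + 16 * D ^+ 4 * v a 7 + D ^+ 2 * v a 8)); last first.
    by move=> a _; rewrite /v /D; set w := _ - _; ring.
  rewrite !sum_ordD -!mulr_sumr sum_central_pow0 sum_central_pow2 sum_central_pow4
    sum_central_pow6 sum_central_pow8 sum_central_pow10 sum_central_pow12
    sum_central_pow14 sum_central_pow16.
  by rewrite !big_cons big_nil /hform /D; cbn [fst snd]; field.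
- by move=> x; rewrite /hform; ring.
Qed.

Lemma conv_sigma_weight22 n :
  \sum_(t <- [:: (18, (3, 17)%N); (280, (5, 15)%N); (1330, (7, 13)%N);
                (2746, (9, 11)%N); (2746, (11, 9)%N); (1330, (13, 7)%N);
                (280, (15, 5)%N); (18, (17, 3)%N)])
    t.1 * conv (sigma F t.2.1) (sigma F t.2.2) n =
  \sum_(t <- [:: (7291%:R / 1108536%:R, 21%N); (- 3 / 20, 17%N); (10 / 9, 15%N);
                (- 133 / 24, 13%N); (1373 / 66, 11%N);
                (- 948743%:R / 16380%:R, 9%N); (665 / 6, 7%N);
                (- 25319%:R / 204, 5%N); (43867%:R / 798, 3%N)])
    t.1 * sigma F t.2 n.
Proof.
rewrite (@conv_relation 7 1 _
  [:: (7291%:R / 1108536%:R, 21%N); (- 3 / 20, 17%N); (10 / 9, 15%N);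
      (- 133 / 24, 13%N); (1373 / 66, 11%N);
      (- 948743%:R / 16380%:R, 9%N); (665 / 6, 7%N);
      (- 25319%:R / 204, 5%N); (43867%:R / 798, 3%N)] 0 0).
- by rewrite [X in _ - X = _]mul0r subr0.
- by move=> a b; rewrite /hform !big_cons big_nil; cbn [fst snd]; ring.
- move=> d d0; rewrite hform_diag //.
  pose D : F := d%:R; pose v (a : 'I_d) k := (D - 2 * a%:R) ^+ (2 * k).
  rewrite (eq_bigr (fun a =>
    2187 * D ^+ 20 * v a 0 + 729 * D ^+ 18 * v a 1
    + (- 2916) * D ^+ 16 * v a 2 + (- 2268) * D ^+ 14 * v a 3
    + 378 * D ^+ 12 * v a 4 + 1134 * D ^+ 10 * v a 5
    + 588 * D ^+ 8 * v a 6 + 148 * D ^+ 6 * v a 7 + 19 * D ^+ 4 * v a 8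
    + D ^+ 2 * v a 9)); last first.
    by move=> a _; rewrite /v /D; set w := _ - _; ring.
  rewrite !sum_ordD -!mulr_sumr sum_central_pow0 sum_central_pow2 sum_central_pow4
    sum_central_pow6 sum_central_pow8 sum_central_pow10 sum_central_pow12
    sum_central_pow14 sum_central_pow16 sum_central_pow18.
  by rewrite !big_cons big_nil /hform /D; cbn [fst snd]; field.
- by move=> x; rewrite /hform; ring.
Qed.

End Relations.

(** * The discriminant as a formal power series *)

Section Convolution.
Variable R : comPzRingType.
Implicit Types a b : nat -> R.

Lemma convC a b n : conv a b n = conv b a n.
Proof.
rewrite /conv (reindex_inj rev_ord_inj) /=; apply: eq_bigr => i _.
by rewrite mulrC subSS subKn // -ltnS.
Qed.

Lemma conv_delta a n : conv (fun i => (i == 0)%:R) a n = a n.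
Proof.
rewrite /conv big_ord_recl subn0 mul1r big1 ?addr0 // => i _.
by rewrite /= mul0r.
Qed.

Lemma sigma0 k : sigma R k 0 = 0.
Proof. by rewrite /sigma /divisor_sum big_pred0. Qed.

Lemma sigma1 k : sigma R k 1 = 1.
Proof.
rewrite /sigma /divisor_sum (big_pred1 ord_max) ?expr1n // => d.
by rewrite dvdn1.
Qed.

Definition eis (c : R) k n : R := (n == 0)%:R + c * sigma R k n.

Lemma conv_eis c k c' k' n : conv (eis c k) (eis c' k') n =
  (n == 0)%:R + c * sigma R k n + c' * sigma R k' n +
  c * c' * conv (sigma R k) (sigma R k') n.
Proof.
transitivity (conv (fun i => (i == 0)%:R) (eis c' k') n +
   c * (conv (fun i => (i == 0)%:R) (sigma R k) n + c' * conv (sigma R k) (sigma R k') n)).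
  rewrite [in X in _ + c * (X + _)]convC /conv.
  rewrite !mulr_sumr -big_split !mulr_sumr -big_split /=.
  by apply: eq_bigr => i _; rewrite /eis; ring.
by rewrite !conv_delta /eis; ring.
Qed.
End Convolution.

(** * Ramanujan's differential equations, coefficientwise *)

Section Ramanujan.
Variable F : numFieldType.

(** The factors -24, 240 and -504 are -2k/B_k for k = 2, 4, 6. *)
Definition E2 := eis (- 24 : F) 1.
Definition E4 := eis (240 : F) 3.
Definition E6 := eis (- 504 : F) 5.

Lemma conv_E4_E4 n : conv E4 E4 n = eis (480 : F) 7 n.
Proof.
have := conv_sigma_weight8 F n.
rewrite !big_cons !big_nil; cbn [fst snd] => e.
rewrite conv_eis /eis.
have -> : conv (sigma F 3) (sigma F 3) n = (sigma F 7 n - sigma F 3 n) / 120.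
  by apply: (@mulfI _ 4); rewrite ?pnatr_eq0 // -[LHS]addr0 e; field.
by field.
Qed.

Lemma ramanujan_E4 n : n%:R * E4 n = (conv E2 E4 n - E6 n) / 3.
Proof.
have := conv_sigma1_weight6 F n.
rewrite !big_cons !big_nil; cbn [fst snd]; rewrite [conv (sigma F 3) _ _]convC => e.
(* Since 24 * 240 = 720 * (4 + 4), the convolution can be laid out as the left side of [e]. *)
have -> : conv E2 E4 n = (n == 0)%:R - 24 * sigma F 1 n + 240 * sigma F 3 n -
   720 * (4 * conv (sigma F 1) (sigma F 3) n + (4 * conv (sigma F 1) (sigma F 3) n + 0)).
  by rewrite conv_eis; ring.
rewrite e /E4 /E6 /eis.
have -> : n%:R * ((n == 0)%:R + 240 * sigma F 3 n) = 240 * (n%:R * sigma F 3 n).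
  by rewrite mulrDr mulrCA; case: n {e} => [|n] /=; rewrite ?(mul0r, mulr0) add0r.
by field.
Qed.

Lemma ramanujan_E6 n : n%:R * E6 n = (conv E2 E6 n - conv E4 E4 n) / 2.
Proof.
have := conv_sigma1_weight8 F n; have := conv_sigma_weight8 F n.
rewrite !big_cons !big_nil; cbn [fst snd]; rewrite [conv (sigma F 5) _ _]convC => e8 e.
(* Here 24 * 504 = 1008 * (6 + 6); the 14 convolutions of sigma_3 with itself in [e] are offset by
   7/2 times [e8]. *)
have -> : conv E2 E6 n = (n == 0)%:R - 24 * sigma F 1 n - 504 * sigma F 5 n +
   1008 * (6 * conv (sigma F 1) (sigma F 5) n + (14 * conv (sigma F 3) (sigma F 3) n +
    (6 * conv (sigma F 1) (sigma F 5) n + 0)) -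
   7 / 2 * (4 * conv (sigma F 3) (sigma F 3) n + 0)).
  by rewrite conv_eis; field.
rewrite e e8 conv_E4_E4 /E6 /eis.
have -> : n%:R * ((n == 0)%:R + - 504 * sigma F 5 n) = - 504 * (n%:R * sigma F 5 n).
  by rewrite mulrDr mulrCA; case: n {e e8} => [|n] /=; rewrite ?(mul0r, mulr0) add0r.
by field.
Qed.
End Ramanujan.

(** * Power series modulo X^(N+1) and logarithmic derivatives *)

Section Truncation.
Variable R : comNzRingType.
Implicit Types (p q : {poly R}) (N : nat).

Definition eq_upto N p q := forall i, (i <= N)%N -> p`_i = q`_i.

Lemma eq_uptoD N p p' q q' :
  eq_upto N p p' -> eq_upto N q q' -> eq_upto N (p + q) (p' + q').
Proof. by move=> ep eq i iN; rewrite !coefD ep ?eq. Qed.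

Lemma eq_uptoN N p p' : eq_upto N p p' -> eq_upto N (- p) (- p').
Proof. by move=> ep i iN; rewrite !coefN ep. Qed.

Lemma eq_uptoM N p p' q q' :
  eq_upto N p p' -> eq_upto N q q' -> eq_upto N (p * q) (p' * q').
Proof.
move=> ep eq i iN; rewrite !coefM; apply: eq_bigr => j _.
have ji : (j <= i)%N by rewrite -ltnS.
by rewrite ep ?(leq_trans ji) // eq // (leq_trans (leq_subr _ _)).
Qed.

Lemma eq_upto_exp1 N p k : eq_upto N p 1 -> eq_upto N (p ^+ k) 1.
Proof.
move=> p1; elim: k => [|k IH]; first by rewrite expr0.
by rewrite exprS -[1]mulr1; apply: eq_uptoM.
Qed.

(** The equation X p' = a p modulo X^(N+1): [a] plays the role of X p'/p without any division. *)
Definition log_deriv N p a := eq_upto N ('X * p^`()) (a * p).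

Lemma log_derivM N p q a b :
  log_deriv N p a -> log_deriv N q b -> log_deriv N (p * q) (a + b).
Proof.
move=> hp hq; rewrite /log_deriv derivM.
have -> : 'X * (p^`() * q + p * q^`()) = 'X * p^`() * q + p * ('X * q^`()) by ring.
have -> : (a + b) * (p * q) = a * p * q + p * (b * q) by ring.
by apply: eq_uptoD; apply: eq_uptoM.
Qed.

Lemma log_deriv1 N : log_deriv N 1 0.
Proof. by rewrite /log_deriv derivC mulr0 mul0r. Qed.

Lemma log_derivX N : log_deriv N 'X 1.
Proof. by rewrite /log_deriv derivX mulr1 mul1r. Qed.

Lemma log_deriv_exp N p a k : log_deriv N p a -> log_deriv N (p ^+ k) (k%:R * a).
Proof.
move=> hp; elim: k => [|k IH]; first by rewrite mul0r; exact: log_deriv1.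
by rewrite exprS -natr1 mulrDl mul1r addrC; exact: log_derivM.
Qed.

Lemma log_deriv_prod N (I : Type) (r : seq I) (f a : I -> {poly R}) (P : pred I) :
    (forall i, P i -> log_deriv N (f i) (a i)) ->
  log_deriv N (\prod_(i <- r | P i) f i) (\sum_(i <- r | P i) a i).
Proof.
move=> h; elim/big_rec2: _ => [|i x y Pi IH]; first exact: log_deriv1.
by apply: log_derivM => //; exact: h.
Qed.

(** The truncation of q^r / (1 - q^r). The ring is arbitrary because [q] is the indeterminate in the
    logarithmic derivative of the product and a complex number in the Lambert series. *)
Definition multiples_sum (A : pzSemiRingType) N r (q : A) : A :=
  \sum_(n < N.+1 | (0 < n)%N && (r %| n)%N) q ^+ n.

Lemma multiples_sumE (A : comPzRingType) N r (q : A) : (0 < r)%N ->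
  multiples_sum N r q * (1 - q ^+ r) = q ^+ r - q ^+ (r * (N %/ r).+1).
Proof.
move=> r0; rewrite /multiples_sum; elim: N => [|N IH].
  by rewrite div0n muln1 subrr big_mkcond big_ord1 /= mul0r.
rewrite big_mkcond big_ord_recr -big_mkcond /= mulrDl IH divnS //.
case: ifP => [dN|_]; last by rewrite add0n mul0r addr0.
have -> : N.+1 = (r * (N %/ r).+1)%N.
  by have := divnS N r0; rewrite dN add1n => <-; rewrite mulnC divnK.
by rewrite add1n [in RHS]mulnS exprD; ring.
Qed.

Lemma sigma_genfun (A : comPzRingType) (k N : nat) (q : A) :
  \sum_(n < N.+1) sigma A k n * q ^+ n =
  \sum_(1 <= r < N.+1) r%:R ^+ k * multiples_sum N r q.
Proof.
rewrite (big_nat_widenl 1 0) // big_mkord.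
under eq_bigr => n _.
  rewrite /sigma /divisor_sum
    (big_ord_widen_cond _ (fun d => (0 < n)%N && (d %| n)%N) (fun d => d%:R ^+ k) (ltn_ord n)).
  rewrite mulr_suml.
over.
rewrite (exchange_big_dep xpredT) //= [RHS]big_mkcond; apply: eq_bigr => r _ /=.
rewrite /multiples_sum mulr_sumr; case: ifP => [_|r0].
  apply: eq_bigl => n; case: (posnP n) => [->//|n0] /=.
  by case rn: (r %| n)%N; rewrite //= ltnS dvdn_leq.
apply: big_pred0 => n; case: (posnP n) => [->//|n0] /=.
by apply/negP => /andP[/dvdn_gt0 -/(_ n0)]; rewrite r0.
Qed.
End Truncation.

(** * The product for Delta and E_4^3 - E_6^2 *)

Section Product.
Variable F : numFieldType.
Implicit Types (n N : nat).

Definition euler_poly N : {poly F} := \prod_(1 <= r < N.+1) (1 - 'X^r) ^+ 24.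

Definition trunc (a : nat -> F) N : {poly F} := \poly_(i < N.+1) a i.

Lemma coef_trunc a N i : (i <= N)%N -> (trunc a N)`_i = a i.
Proof. by move=> iN; rewrite coef_poly ltnS iN. Qed.

Lemma coef_truncM a b N i : (i <= N)%N -> (trunc a N * trunc b N)`_i = conv a b i.
Proof.
move=> iN; rewrite coefM; apply: eq_bigr => j _.
have ji : (j <= i)%N by rewrite -ltnS.
by rewrite !coef_trunc ?(leq_trans _ iN) ?leq_subr.
Qed.

Lemma coef_trunc_cube a N i :
  (i <= N)%N -> (trunc a N ^+ 3)`_i = conv (conv a a) a i.
Proof.
move=> iN; rewrite -(coef_truncM _ _ iN) exprSr expr2; move: i iN.
apply: eq_uptoM => // i iN.
by rewrite coef_truncM // coef_trunc.
Qed.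

(** Each factor contributes -24 r X^r / (1 - X^r) and the leading X contributes 1; regrouped by
    powers of X, the total is 1 - 24 sum_n sigma_1(n) X^n. *)
Lemma log_deriv_euler_poly N : log_deriv N ('X * euler_poly N) (trunc (E2 F) N).
Proof.
have h r : (0 < r)%N ->
    log_deriv N ((1 - 'X^r : {poly F}) ^+ 24) (24%:R * (- r%:R * multiples_sum N r 'X)).
  move=> r0; apply: log_deriv_exp; rewrite /log_deriv -mulrA multiples_sumE //.
  move=> i iN; have lt_i : (i < r * (N %/ r).+1)%N.
    by rewrite (leq_ltn_trans iN) // mulnC ltn_ceil.
  rewrite derivB derivC sub0r derivXn mulrN mulrnAr -exprS prednK //.
  rewrite !mulNr -mulr_natl !coefN; congr (- _).
  by rewrite -!polyC_natr !coefCM coefB [X in _ - X]coefXn (ltn_eqF lt_i) subr0.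
have -> : trunc (E2 F) N =
    1 + \sum_(1 <= r < N.+1) 24%:R * (- r%:R * multiples_sum N r 'X).
  rewrite /trunc poly_def.
  transitivity (\sum_(i < N.+1)
    ((i == 0 :> nat)%:R + (- 24) * (sigma _ 1 i * 'X^i)) : {poly F}).
    apply: eq_bigr => i _; rewrite /E2 /eis scalerDl -scalerA; congr (_ + _).
      by case: eqP => [->|_]; rewrite ?scale0r // expr0 scale1r.
    rewrite -mul_polyC polyCN -polyC_natr; congr (_ * _); rewrite -mul_polyC; congr (_ * _).
    rewrite /sigma /divisor_sum rmorph_sum; apply: eq_bigr => d _.
    by rewrite rmorphXn /= polyC_natr.
  rewrite big_split /= big_ord_recl big1 // addr0; congr (_ + _).
  rewrite -mulr_sumr sigma_genfun mulr_sumr; apply: eq_bigr => r _.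
  by rewrite expr1; ring.
apply: log_derivM; first exact: log_derivX.
rewrite /euler_poly big_seq [X in log_deriv _ _ X]big_seq.
apply: log_deriv_prod => r; rewrite mem_index_iota => /andP[r0 _]; exact: h.
Qed.

(** In 3 E_4^2 (E_2 E_4 - E_6) / 3 - 2 E_6 (E_2 E_6 - E_4^2) / 2 the terms E_4^2 E_6 cancel. *)
Lemma log_deriv_discriminant N :
  log_deriv N (trunc (E4 F) N ^+ 3 - trunc (E6 F) N ^+ 2) (trunc (E2 F) N).
Proof.
set A2 := trunc (E2 F) N; set A4 := trunc (E4 F) N; set A6 := trunc (E6 F) N.
have coefXd (p : {poly F}) i : ('X * p^`())`_i = i%:R * p`_i.
  by rewrite coefXM; case: i => [|i] /=; rewrite ?mul0r // coef_deriv mulr_natl.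
have h4 : eq_upto N ('X * A4^`()) (3^-1%:P * (A2 * A4 - A6)).
  move=> i iN; rewrite coefXd coefCM coefB coef_truncM // !coef_trunc //.
  by rewrite ramanujan_E4 mulrC.
have h6 : eq_upto N ('X * A6^`()) (2^-1%:P * (A2 * A6 - A4 * A4)).
  move=> i iN; rewrite coefXd coefCM coefB !coef_truncM // !coef_trunc //.
  by rewrite ramanujan_E6 mulrC.
have c3 : 3 * 3^-1%:P = 1 :> {poly F} by rewrite -(polyC_natr _ 3) -polyCM divff ?pnatr_eq0.
have c2 : 2 * 2^-1%:P = 1 :> {poly F} by rewrite -(polyC_natr _ 2) -polyCM divff ?pnatr_eq0.
rewrite /log_deriv derivB !expr2 exprS expr2 !derivM.
have -> : 'X * (A4^`() * (A4 * A4) + A4 * (A4^`() * A4 + A4 * A4^`()) -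
               (A6^`() * A6 + A6 * A6^`()))
  = 3 * (A4 * A4) * ('X * A4^`()) + - (2 * A6 * ('X * A6^`())) by ring.
have -> : A2 * (A4 * (A4 * A4) - A6 * A6) =
    3 * (A4 * A4) * (3^-1%:P * (A2 * A4 - A6)) + - (2 * A6 * (2^-1%:P * (A2 * A6 - A4 * A4))).
  transitivity ((3 * 3^-1%:P) * (A4 * A4) * (A2 * A4 - A6) -
                (2 * 2^-1%:P) * A6 * (A2 * A6 - A4 * A4)).
    by rewrite c2 c3; ring.
  by ring.
by apply: eq_uptoD; last apply: eq_uptoN; apply: eq_uptoM.
Qed.

(** As [a 0 = 1], coefficient i of the equation gives (i - 1) p_i in terms of lower coefficients.
    Only i = 1 is left undetermined; in particular p_0 = 0. *)
Lemma log_deriv_unique N (a : nat -> F) (p q : {poly F}) : a 0 = 1 -> (0 < N)%N ->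
  log_deriv N p (trunc a N) -> log_deriv N q (trunc a N) -> p`_1 = q`_1 -> eq_upto N p q.
Proof.
move=> a0 N0 hp hq pq1.
have coefXd (r : {poly F}) i : ('X * r^`())`_i = i%:R * r`_i.
  by rewrite coefXM; case: i => [|i] /=; rewrite ?mul0r // coef_deriv mulr_natl.
have rec (r : {poly F}) i : log_deriv N r (trunc a N) -> (i <= N)%N ->
    (i%:R - 1) * r`_i = \sum_(j < i) a j.+1 * r`_(i - j.+1).
  move=> hr iN; have := hr i iN.
  rewrite coefXd coefM big_ord_recl /= subn0 coef_trunc // a0 mul1r mulrBl mul1r => ->.
  rewrite addrC addKr; apply: eq_bigr => j _; rewrite coef_trunc //= /bump add1n.
  exact: leq_trans (ltn_ord j) iN.
move=> i; elim/ltn_ind: i => i IH iN.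
have [->//|i1] := eqVneq i 1%N.
have nz : i%:R - 1 != 0 :> F by rewrite subr_eq0 pnatr_eq1.
apply: (mulfI nz); rewrite !rec //; apply: eq_bigr => j _.
by have jlt := ltn_ord j; rewrite IH //; lia.
Qed.

Lemma eq_upto_euler_poly N M : (N <= M)%N -> eq_upto N (euler_poly M) (euler_poly N).
Proof.
move=> NM; rewrite -(subnK NM) addnC; elim: (M - N)%N => [|k IH]; first by rewrite addn0.
rewrite addnS [X in eq_upto _ X]/euler_poly big_nat_recr //= -/(euler_poly _).
rewrite -[euler_poly N]mulr1.
apply: eq_uptoM => //; apply: eq_upto_exp1 => i iN.
by rewrite coefB coefXn ltn_eqF ?subr0 // ltnS (leq_trans iN) // leq_addr.
Qed.

(** The coefficient in the infinite product: factors of index above n do not affect it. *)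
Definition euler_coef n : F := (euler_poly n)`_n.

Lemma discriminant_coef n :
  conv (conv (E4 F) (E4 F)) (E4 F) n - conv (E6 F) (E6 F) n =
  1728 * (if n is m.+1 then euler_coef m else 0).
Proof.
(* The truncation order must be positive even for n = 0, so that the coefficient of X is in
   range. *)
pose N := n.+1.
have nN : (n <= N)%N by [].
have c1728 : 1728%:R = 1728 :> {poly F} by [].
have key : eq_upto N (trunc (E4 F) N ^+ 3 - trunc (E6 F) N ^+ 2) (1728 * ('X * euler_poly N)).
  apply: (@log_deriv_unique N (E2 F)) => //.
  - by rewrite /E2 /eis sigma0 mulr0 addr0.
  - exact: log_deriv_discriminant.
  - rewrite -[trunc _ _]add0r; apply: log_derivM; last exact: log_deriv_euler_poly.
    by rewrite /log_deriv -polyC_natr derivC mulr0 mul0r.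
  (* The coefficient of X is 3 * 240 + 2 * 504 = 1728. *)
  rewrite coefB coef_trunc_cube // expr2 coef_truncM //.
  rewrite -polyC_natr coefCM coefXM [(euler_poly N)`_ _](eq_upto_euler_poly (leq0n N)) //.
  rewrite /euler_poly big_geq // coef1 /conv ?(big_ord_recl, big_ord0) /=.
  rewrite /E4 /E6 /eis /bump /= !sigma0 !sigma1.
  by ring.
have := key n nN; rewrite coefB coef_trunc_cube // expr2 coef_truncM //.
move=> ->; rewrite -polyC_natr coefCM coefXM; congr (_ * _).
case: (n) @N nN {key} => [//|m] N nN /=; rewrite /euler_coef.
by apply: eq_upto_euler_poly => //; rewrite leqW.
Qed.
End Product.

(** * Bernoulli numbers *)

Section Bernoulli.
Variables (F : numFieldType) (B : nat -> F).
Hypothesis HB :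
  forall n, \sum_(i < n.+1) B i / i`!%:R / (n.+1 - i)`!%:R = (n == 0)%:R.

(* [\sum_i 'C(m, k + i) / 'C(m, k) * ws`_i], nested so that the binomial
   coefficients are never computed. *)
Fixpoint bin_horner (m k : nat) (ws : seq F) : F :=
  if ws is w :: ws' then
    w + (m%:R - k%:R) / k.+1%:R * bin_horner m k.+1 ws'
  else 0.

Lemma bin_hornerE (m k : nat) (ws : seq F) : (k + size ws <= m)%N ->
  \sum_(i < size ws) ws`_i / (k + i)`!%:R / (m - (k + i))`!%:R =
  bin_horner m k ws / k`!%:R / (m - k)`!%:R.
Proof.
elim: ws k => [|w ws IH] k /= le; first by rewrite big_ord0 !mul0r.
rewrite big_ord_recl /= addn0 2!mulrDl; congr (_ + _).
transitivity (\sum_(i < size ws) ws`_i / (k.+1 + i)`!%:R / (m - (k.+1 + i))`!%:R).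
  by apply: eq_bigr => i _; rewrite /= /bump add1n addnS addSn.
rewrite IH ?addSn -?addnS //.
have -> : (m - k = (m - k.+1).+1)%N by lia.
have -> : m%:R - k%:R = (m - k.+1).+1%:R :> F by rewrite -natrB; [congr _%:R|]; lia.
rewrite !factS !natrM; field.
by rewrite ![1 + _]addrC !natr1 !pnatr_eq0 -!lt0n !fact_gt0.
Qed.

Definition known (ws : seq F) := forall i, (i < size ws)%N -> B i = ws`_i.

(** In the recurrence of index n = [size ws] the unknown B_n has the nonzero coefficient 1/n!, so a
    value that satisfies the recurrence together with the known ones must be B_n. *)
Lemma known_rcons (ws : seq F) v : known ws ->
  bin_horner (size ws).+1 0 (rcons ws v) = (size ws == 0)%:R -> known (rcons ws v).
Proof.
move=> kw hv; have fN k : (k`!%:R)^-1 != 0 :> F.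
  by rewrite invr_neq0 // pnatr_eq0 -lt0n fact_gt0.
suff Bv : v = B (size ws).
  move=> i; rewrite size_rcons ltnS nth_rcons leq_eqVlt => /predU1P[->|lt].
    by rewrite ltnn eqxx Bv.
  by rewrite lt kw.
have := @bin_hornerE (size ws).+1 0 (rcons ws v); rewrite size_rcons add0n leqnn => /(_ isT).
rewrite hv subn0 fact0 divr1.
have -> : (size ws == 0)%:R / (size ws).+1`!%:R = (size ws == 0)%:R :> F.
  by case: (size ws) => [|n]; [rewrite divr1|rewrite mul0r].
rewrite -(HB (size ws)) !big_ord_recr /= add0n nth_rcons ltnn eqxx.
rewrite (eq_bigr (fun i : 'I_(size ws) => B i / i`!%:R / ((size ws).+1 - i)`!%:R)); last first.
  by move=> i _; rewrite add0n nth_rcons ltn_ord kw.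
by move/addrI/mulIf => /(_ (fN _)) /mulIf => /(_ (fN _)).
Qed.

Lemma known_rcons_gt0 (ws : seq F) v : known ws -> (0 < size ws)%N ->
  bin_horner (size ws).+1 0 (rcons ws v) = 0 -> known (rcons ws v).
Proof. by move=> kw ws0 h; apply: known_rcons; rewrite // h gtn_eqF. Qed.

Local Ltac next_value k v k' :=
  lapply (@known_rcons_gt0 _ v k isT); cbn [rcons size bin_horner];
  [move=> k' | by field].

Lemma bernoulli_values : known
  [:: 1;
      - 1 / 2;
      1 / 6;
      0;
      - 1 / 30;
      0;
      1 / 42;
      0;
      - 1 / 30;
      0;
      5 / 66;
      0;
      - 691 / 2730;
      0;
      7 / 6;
      0;
      - 3617 / 510;
      0;
      43867%:R / 798;
      0;
      - 174611%:R / 330;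
      0;
      854513%:R / 138].
Proof.
have k1 : known [:: 1].
  apply: (@known_rcons [::]) => //; cbn [rcons size bin_horner].
  by rewrite mulr0 addr0.
next_value k1 (- 1 / 2 : F) k2.
next_value k2 (1 / 6 : F) k3.
next_value k3 (0 : F) k4.
next_value k4 (- 1 / 30 : F) k5.
next_value k5 (0 : F) k6.
next_value k6 (1 / 42 : F) k7.
next_value k7 (0 : F) k8.
next_value k8 (- 1 / 30 : F) k9.
next_value k9 (0 : F) k10.
next_value k10 (5 / 66 : F) k11.
next_value k11 (0 : F) k12.
next_value k12 (- 691 / 2730 : F) k13.
next_value k13 (0 : F) k14.
next_value k14 (7 / 6 : F) k15.
next_value k15 (0 : F) k16.
next_value k16 (- 3617 / 510 : F) k17.
next_value k17 (0 : F) k18.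
next_value k18 (43867%:R / 798 : F) k19.
next_value k19 (0 : F) k20.
next_value k20 (- 174611%:R / 330 : F) k21.
next_value k21 (0 : F) k22.
next_value k22 (854513%:R / 138 : F) k23.
exact: k23.
Qed.
End Bernoulli.

(** * Power series over the complex numbers *)

Section Complex.
Import ComplexField.Normc.
Local Open Scope classical_set_scope.
Variable R : realType.
Implicit Types (z w l : R[i]) (u v a b : nat -> R[i]).

Lemma normC_normc z : `|z| = (normc z)%:C%C. Proof. by []. Qed.

Lemma normc_ge0 z : 0 <= normc z. Proof. by case: z => x y; exact: sqrtr_ge0. Qed.

Lemma normcX z n : normc (z ^+ n) = normc z ^+ n.
Proof. by elim: n => [|n IH]; rewrite ?expr0 ?normc1 // !exprS normcM IH. Qed.

Lemma normc_sum (I : Type) (r : seq I) (P : pred I) (f : I -> R[i]) :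
  normc (\sum_(i <- r | P i) f i) <= \sum_(i <- r | P i) normc (f i).
Proof.
elim/big_rec2: _ => [|i x y _ IH]; first by rewrite normc0.
exact: le_trans (le_normcD _ _) (lerD _ IH).
Qed.

Lemma normc_real (x : R) : normc x%:C%C = `|x|.
Proof. by rewrite /= expr0n addr0 sqrtr_sqr. Qed.

Lemma normc_le (x y : R) : normc (Complex x y) <= `|x| + `|y|.
Proof.
have -> : Complex x y = x%:C%C + 'i%C * y%:C%C by rewrite [LHS]complexE.
apply: le_trans (le_normcD _ _) _; rewrite normcM !normc_real.
by rewrite lerD2l /= expr0n add0r expr1n sqrtr1 mul1r.
Qed.

(** Brings convergence in R[i] down to real estimates; a positive element of R[i] has imaginary part
    0. *)
Lemma cvgC_bound u l (e : nat -> R) :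
  (forall n, normc (u n - l) <= e n) -> e @ \oo --> (0 : R) -> u @ \oo --> l.
Proof.
move=> ue e0; apply/cvgrPdist_lt => eps eps0.
have [eI eR] : complex.Im eps = 0 /\ 0 < complex.Re eps.
  by move: eps0; rewrite ltcE => /andP[/eqP -> ?].
have -> : eps = (complex.Re eps)%:C%C by rewrite [LHS]complexE eI mulr0 addr0.
move/cvgrPdist_lt: e0 => /(_ _ eR).
apply: filterS => n; rewrite sub0r normrN => h.
rewrite distrC normC_normc ltcR.
exact: le_lt_trans (ue n) (le_lt_trans (ler_norm _) h).
Qed.

Lemma cvgC_dist u l : u @ \oo --> l -> forall e : R, 0 < e ->
  \forall n \near \oo, normc (u n - l) < e.
Proof.
move=> /cvgrPdist_lt h e e0.
have : (0 : R[i]) < e%:C%C by rewrite ltcR.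
by move=> /h; apply: filterS => n; rewrite distrC normC_normc ltcR.
Qed.

Lemma cvgC_unique u l l' : u @ \oo --> l -> u @ \oo --> l' -> l = l'.
Proof. by move=> h h'; apply: (cvg_unique _ h h'). Qed.

Lemma cvgC_add u v l l' : u @ \oo --> l -> v @ \oo --> l' ->
  (fun n => u n + v n) @ \oo --> l + l'.
Proof. by move=> ul vl; exact: (@cvgD R[i] R[i]^o _ _ _ u v l l' ul vl). Qed.

Lemma cvgC_mul u v l l' : u @ \oo --> l -> v @ \oo --> l' ->
  (fun n => u n * v n) @ \oo --> l * l'.
Proof. by move=> ul vl; exact: (@cvgM R[i] nat \oo _ u v l l' ul vl). Qed.

Lemma sum_geo_le (r : R) N M : 0 <= r -> r < 1 ->
  \sum_(N <= n < M) r ^+ n <= r ^+ N / (1 - r).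
Proof.
move=> r0 r1; have d0 : 0 < 1 - r by rewrite subr_gt0.
rewrite ler_pdivlMr //.
have [NM|MN] := leqP N M; last first.
  by rewrite big_geq ?mul0r ?exprn_ge0 // ltnW.
have -> : (\sum_(N <= n < M) r ^+ n) * (1 - r) = r ^+ N - r ^+ M.
  rewrite -opprB -[RHS]opprB -(@telescope_sumr _ _ _ (fun n => r ^+ n)) //.
  rewrite mulrN big_distrl /=; congr (- _); apply: eq_bigr => n _.
  by rewrite exprS; ring.
by rewrite lerBlDr lerDl exprn_ge0.
Qed.

(** With s = sqrt r, split r^n = s^n s^n; then (n + 1) s^n is at most the sum of s^i for i <= n,
    hence at most 1/(1 - s). *)
Lemma linear_geo_le (r : R) n : 0 <= r -> r < 1 ->
  n.+1%:R * r ^+ n <= (1 - Num.sqrt r)^-1 * Num.sqrt r ^+ n.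
Proof.
move=> r0 r1; set s := Num.sqrt r.
have s0 : 0 <= s by exact: sqrtr_ge0.
have s1 : s < 1 by rewrite -sqrtr1 ltr_sqrt.
rewrite -(sqr_sqrtr r0) -/s -exprM mulnC exprM expr2 mulrA ler_wpM2r ?exprn_ge0 //.
have := sum_geo_le 0 n.+1 s0 s1; rewrite expr0 mul1r; apply: le_trans.
rewrite big_mkord mulr_natl -[leLHS]/(_ *+ _) -{1}(card_ord n.+1) -sumr_const.
apply: ler_sum => i _; apply: ler_wiXn2l => //; first exact: ltW.
by rewrite -ltnS.
Qed.

Lemma cvg_geo0 (K r : R) : 0 <= r -> r < 1 -> (fun n => K * r ^+ n) @ \oo --> (0 : R).
Proof. by move=> r0 r1; apply: cvg_geometric; rewrite ger0_norm. Qed.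

(** Domination by a geometric sequence implies summability and, unlike convergence alone, passes to
    Cauchy products. *)
Definition geo_bounded a := exists K r : R,
  [/\ 0 <= K, 0 <= r, r < 1 & forall n, normc (a n) <= K * r ^+ n].

Definition psum (a : nat -> R[i]) N := \sum_(n < N) a n.

Lemma geo_bounded_cvg a : geo_bounded a -> exists l, psum a @ \oo --> l.
Proof.
move=> [K [r [K0 r0 r1 ab]]].
have cv (f : R[i] -> R) (fD : {morph f : x y / x + y}) (f0 : f 0 = 0)
    (fle : forall z, `|f z| <= normc z) : cvgn (fun N => f (psum a N)).
  have -> : (fun N => f (psum a N)) = series (fun n => f (a n)).
    by apply/funext => N; rewrite /psum (big_morph f fD f0) /series /= big_mkord.
  apply: normed_cvg.
  apply: (@series_le_cvg _ _ (geometric K r)) => [n|n|n|].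
  - exact: normr_ge0.
  - by rewrite mulr_ge0 ?exprn_ge0.
  - exact: le_trans (fle _) (ab n).
  by apply: is_cvg_geometric_series; rewrite ger0_norm.
have cR := cv (@complex.Re R).
have cI := cv (@complex.Im R).
have {cR} cR : cvgn (fun N => complex.Re (psum a N)).
  apply: cR => [[x y] [x' y']//|//|[x y]] /=.
  by rewrite -sqrtr_sqr ler_wsqrtr // lerDl sqr_ge0.
have {cI} cI : cvgn (fun N => complex.Im (psum a N)).
  apply: cI => [[x y] [x' y']//|//|[x y]] /=.
  by rewrite -sqrtr_sqr ler_wsqrtr // lerDr sqr_ge0.
pose lR := limn (fun N => complex.Re (psum a N)).
pose lI := limn (fun N => complex.Im (psum a N)).
exists (Complex lR lI).
apply: (@cvgC_bound _ _ (fun N =>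
  `|complex.Re (psum a N) - lR| + `|complex.Im (psum a N) - lI|)).
  by move=> N; case: (psum a N) => x y /=; exact: normc_le.
rewrite -[0]addr0; apply: cvgD; rewrite -(normr0 R).
  by apply: cvg_norm; apply/subr_cvg0.
by apply: cvg_norm; apply/subr_cvg0.
Qed.

End Complex.

(** * Summation of geometrically bounded sequences *)

Section Sums.
Import ComplexField.Normc.
Local Open Scope classical_set_scope.
Variable R : realType.
Implicit Types (z w l : R[i]) (u v a b : nat -> R[i]).

Definition sums a l := geo_bounded a /\ psum a @ \oo --> l.

Lemma sums_exists a : geo_bounded a -> exists l, sums a l.
Proof. by move=> h; have [l al] := geo_bounded_cvg h; exists l. Qed.

Lemma sums_unique a l l' : sums a l -> sums a l' -> l = l'.
Proof. by move=> [_ h] [_ h']; exact: cvgC_unique h h'. Qed.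

Lemma eq_sums a b l : a =1 b -> sums a l -> sums b l.
Proof. by move=> /funext ->. Qed.

Lemma geo_bounded2 a b : geo_bounded a -> geo_bounded b -> exists K r : R,
  [/\ 0 <= K, 0 <= r, r < 1, forall n, normc (a n) <= K * r ^+ n
    & forall n, normc (b n) <= K * r ^+ n].
Proof.
move=> [K [r [K0 r0 r1 ha]]] [K' [r' [K'0 r'0 r'1 hb]]].
exists (Num.max K K'), (Num.max r r'); split.
- by rewrite le_max K0.
- by rewrite le_max r0.
- by rewrite gt_max r1 r'1.
- move=> n; apply: le_trans (ha n) _; apply: ler_pM; rewrite ?exprn_ge0 ?le_max ?lexx //.
  by apply: lerXn2r; rewrite ?nnegrE ?le_max ?r0 ?lexx.
move=> n; apply: le_trans (hb n) _; apply: ler_pM; rewrite ?exprn_ge0 ?le_max ?lexx ?orbT //.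
by apply: lerXn2r; rewrite ?nnegrE ?le_max ?r'0 ?lexx ?orbT.
Qed.

Lemma sumsD a b l m : sums a l -> sums b m -> sums (fun n => a n + b n) (l + m).
Proof.
move=> [ga al] [gb bm]; split.
  have [K [r [K0 r0 r1 ha hb]]] := geo_bounded2 ga gb.
  exists (K + K), r; split=> //; first exact: addr_ge0.
  by move=> n; apply: le_trans (le_normcD _ _) _; rewrite mulrDl lerD.
have -> : psum (fun n => a n + b n) = (fun N => psum a N + psum b N).
  by apply/funext => N; rewrite /psum big_split.
exact: (cvgC_add al bm).
Qed.

Lemma sumsZ a l c : sums a l -> sums (fun n => c * a n) (c * l).
Proof.
move=> [[K [r [K0 r0 r1 ha]]] al]; split.
  exists (normc c * K), r; split=> //; first by rewrite mulr_ge0 ?normc_ge0.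
  by move=> n; rewrite normcM -mulrA ler_wpM2l ?normc_ge0.
have -> : psum (fun n => c * a n) = (fun N => c * psum a N).
  by apply/funext => N; rewrite /psum mulr_sumr.
by exact: (cvgC_mul (cvg_cst c) al).
Qed.

Lemma sums_finite a N : (forall n, (N <= n)%N -> a n = 0) -> sums a (psum a N).
Proof.
(* With ratio 1/2, this K dominates every nonzero term by construction. *)
move=> a0; pose K := \sum_(n < N) normc (a n) * 2 ^+ n.
have pos n : 0 <= normc (a n) * 2 ^+ n by rewrite mulr_ge0 ?normc_ge0 ?exprn_ge0.
split.
  exists K, 2^-1; split; rewrite ?invr_ge0 ?sumr_ge0 //; first by lra.
  move=> n; have [Nn|nN] := leqP N n.
    by rewrite a0 // normc0 mulr_ge0 ?exprn_ge0 ?sumr_ge0.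
  rewrite exprVn ler_pdivlMr ?exprn_gt0 // /K (bigD1 (Ordinal nN)) //= lerDl.
  exact: sumr_ge0.
apply: cvg_near_cst; exists N => // M /= NM.
rewrite /psum -!(big_mkord xpredT a) (big_cat_nat (n := N)) //=.
by rewrite [X in _ + X]big_nat_cond [X in _ + X]big1 ?addr0 // => n /andP[/andP[/a0]].
Qed.

Lemma normc_conv a b (K r : R) n : 0 <= K -> 0 <= r ->
  (forall n, normc (a n) <= K * r ^+ n) -> (forall n, normc (b n) <= K * r ^+ n) ->
  normc (conv a b n) <= K ^+ 2 * (n.+1%:R * r ^+ n).
Proof.
move=> K0 r0 ha hb; apply: le_trans (normc_sum _ _ _) _.
apply: le_trans (_ : \sum_(i < n.+1) K ^+ 2 * r ^+ n <= _); last first.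
  by rewrite sumr_const card_ord -[leLHS]mulr_natl mulrCA.
apply: ler_sum => i _; rewrite normcM.
have -> : K ^+ 2 * r ^+ n = (K * r ^+ i) * (K * r ^+ (n - i)).
  by rewrite mulrACA -expr2 -exprD subnKC // -ltnS.
by apply: ler_pM; rewrite ?normc_ge0.
Qed.

(** Partial sums are values at 1 of the truncations A and B. Below N the coefficients of AB are
    those of the convolution; from N to 2N - 1 they obey the same geometric bound, so the
    discrepancy is a geometric tail. *)
Lemma sums_conv a b l m : sums a l -> sums b m -> sums (conv a b) (l * m).
Proof.
move=> [ga al] [gb bm].
have [K [r [K0 r0 r1 ha hb]]] := geo_bounded2 ga gb.
set s := Num.sqrt r; pose L := K ^+ 2 * (1 - s)^-1.
have s0 : 0 <= s by exact: sqrtr_ge0.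
have s1 : s < 1 by rewrite -sqrtr1 ltr_sqrt.
have L0 : 0 <= L by rewrite mulr_ge0 ?exprn_ge0 // invr_ge0 subr_ge0 ltW.
have hL n : K ^+ 2 * (n.+1%:R * r ^+ n) <= L * s ^+ n.
  by rewrite /L -[leRHS]mulrA ler_wpM2l ?exprn_ge0 // linear_geo_le.
split.
  exists L, s; split=> // n; exact: le_trans (normc_conv n K0 r0 ha hb) (hL n).
have -> : psum (conv a b) = (fun N => psum a N * psum b N +
    (psum (conv a b) N - psum a N * psum b N)).
  by apply/funext => N /=; rewrite addrC subrK.
rewrite -[l * m]addr0; apply: (cvgC_add (cvgC_mul al bm)).
apply: (@cvgC_bound _ _ _ (fun N => L / (1 - s) * s ^+ N)); last exact: cvg_geo0.
move=> N; rewrite subr0.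
pose A := \poly_(i < N) a i; pose B := \poly_(i < N) b i.
have eA : psum a N = A.[1].
  rewrite (horner_coef_wide _ (size_poly _ _)); apply: eq_bigr => i _.
  by rewrite expr1n mulr1 coef_poly ltn_ord.
have eB : psum b N = B.[1].
  rewrite (horner_coef_wide _ (size_poly _ _)); apply: eq_bigr => i _.
  by rewrite expr1n mulr1 coef_poly ltn_ord.
have bound (f : nat -> R[i]) n : (forall n, normc (f n) <= K * r ^+ n) ->
    normc (\poly_(i < N) f i)`_n <= K * r ^+ n.
  by move=> hf; rewrite coef_poly; case: ifP => // _; rewrite normc0 mulr_ge0 ?exprn_ge0.
have sAB : (size (A * B)%R <= N + N)%N.
  apply: leq_trans (size_polyMleq _ _) _; apply: leq_trans (leq_pred _) _.
  by rewrite leq_add // size_poly.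
rewrite eA eB -hornerM (horner_coef_wide _ sAB) /psum.
rewrite -(big_mkord xpredT (fun i => (A * B)`_i * 1 ^+ i)).
rewrite (big_cat_nat (n := N)) ?leq_addr //= big_mkord opprD addrA -sumrB.
rewrite big1 ?add0r => [|n _]; last first.
  rewrite expr1n mulr1 coefM; apply/eqP; rewrite subr_eq0; apply/eqP; apply: eq_bigr => i _.
  have lt1 := ltn_ord n; have lt2 := ltn_ord i.
  by rewrite !coef_poly !ifT //; lia.
rewrite normcN; apply: le_trans (normc_sum _ _ _) _.
apply: le_trans (_ : \sum_(N <= n < N + N) L * s ^+ n <= _).
  apply: ler_sum => n _; rewrite expr1n mulr1 coefM.
  apply: le_trans (hL n); apply: (normc_conv n K0 r0) => k; exact: bound.
by rewrite -mulr_sumr -mulrA ler_wpM2l // mulrC sum_geo_le.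
Qed.

End Sums.

(** * Lambert series and the infinite product at a complex point *)

Section Analysis.
Import ComplexField.Normc.
Local Open Scope classical_set_scope.
Variable R : realType.
Implicit Types (q z w l : R[i]) (u v a b : nat -> R[i]).

Lemma poly_geo_le (s : nat) (r : R) : 0 <= r -> r < 1 -> exists K r' : R,
  [/\ 0 <= K, 0 <= r', r' < 1 & forall n, n.+1%:R ^+ s * r ^+ n <= K * r' ^+ n].
Proof.
move=> r0 r1; elim: s => [|s [K [r' [K0 r'0 r'1 h]]]].
  by exists 1, r; split=> // n; rewrite expr0 !mul1r.
exists (K / (1 - Num.sqrt r')), (Num.sqrt r'); split.
- by rewrite mulr_ge0 // invr_ge0 subr_ge0 ltW // -sqrtr1 ltr_sqrt.
- exact: sqrtr_ge0.
- by rewrite -sqrtr1 ltr_sqrt.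
move=> n; rewrite exprS -mulrA; apply: le_trans (ler_wpM2l _ (h n)) _ => //.
by rewrite mulrCA -[leRHS]mulrA ler_wpM2l // linear_geo_le.
Qed.

Lemma normc_nat n : normc (n%:R : R[i]) = n%:R.
Proof. by rewrite -(rmorph_nat (real_complex R)) normc_real normr_nat. Qed.

Lemma normc_sigma k n : normc (sigma R[i] k n) <= n.+1%:R ^+ k.+1.
Proof.
apply: le_trans (normc_sum _ _ _) _.
apply: le_trans (_ : \sum_(d < n.+1) n.+1%:R ^+ k <= _); last first.
  by rewrite sumr_const card_ord exprS -[leLHS]mulr_natl.
rewrite big_mkcond; apply: ler_sum => d _; case: ifP => _; last exact: exprn_ge0.
by rewrite normcX normc_nat lerXn2r ?nnegrE // ler_nat ltnW.
Qed.

Lemma geo_bounded_sigma k q : normc q < 1 ->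
  geo_bounded (fun n => sigma R[i] k n * q ^+ n).
Proof.
move=> q1; have [K [r [K0 r0 r1 h]]] := poly_geo_le k.+1 (normc_ge0 q) q1.
exists K, r; split=> // n; apply: le_trans (h n).
by rewrite normcM normcX ler_wpM2r ?exprn_ge0 ?normc_ge0 // normc_sigma.
Qed.

Lemma normc_1B_ge q r : normc q < 1 -> (0 < r)%N -> 1 - normc q <= normc (1 - q ^+ r).
Proof.
move=> q1 r0; apply: le_trans (_ : 1 - normc (q ^+ r) <= _).
  rewrite lerD2l lerN2 normcX -(prednK r0) exprS ler_piMr ?normc_ge0 //.
  by rewrite exprn_ile1 ?normc_ge0 // ltW.
by rewrite lerBlDr -[leLHS](@normc1 R) -{1}(subrK (q ^+ r) 1) le_normcD.
Qed.

(** The d-th Lambert term exceeds its part of degree at most N by d^k q^(d (N %/ d + 1)) / (1 -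
    q^d), whose exponent is above N. The N discrepancies together are at most N (N+1)^k |q|^N / (1 -
    |q|). *)
Lemma lambert_cvg k q S : normc q < 1 -> sums (fun n => sigma R[i] k n * q ^+ n) S ->
  (fun N => \sum_(1 <= r < N.+1) r%:R ^+ k * q ^+ r / (1 - q ^+ r)) @ \oo --> S.
Proof.
move=> q1 [_ hS]; set f := (f in f @ _ --> _).
have q0 := normc_ge0 q; have d0 : 0 < 1 - normc q by rewrite subr_gt0.
pose g N := psum (fun n => sigma R[i] k n * q ^+ n) N.+1.
have -> : f = (fun N => g N + (f N - g N)) by apply/funext => N; rewrite addrC subrK.
rewrite -[S]addr0; apply: cvgC_add; first by move: hS; rewrite -cvg_shiftS.
have [K [r [K0 r0 r1 hK]]] := poly_geo_le k.+1 q0 q1.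
apply: (@cvgC_bound _ _ _ (fun N => K / (1 - normc q) * r ^+ N)); last exact: cvg_geo0.
move=> N; rewrite subr0 /f /g /psum sigma_genfun -sumrB.
apply: le_trans (normc_sum _ _ _) _.
apply: le_trans (_ : \sum_(1 <= r < N.+1) N.+1%:R ^+ k * normc q ^+ N / (1 - normc q) <= _).
  apply: ler_sum_nat => d /andP[d1 dN].
  have nz : 1 - q ^+ d != 0.
    apply/eqP => e; have := normc_1B_ge q1 d1.
    by rewrite e normc0 leNgt d0.
  have -> : d%:R ^+ k * q ^+ d / (1 - q ^+ d) - d%:R ^+ k * multiples_sum N d q =
      d%:R ^+ k * q ^+ (d * (N %/ d).+1) / (1 - q ^+ d).
    have -> : multiples_sum N d q = (q ^+ d - q ^+ (d * (N %/ d).+1)) / (1 - q ^+ d).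
      by rewrite -multiples_sumE // mulfK.
    by field.
  rewrite !normcM normcV !normcX normc_nat.
  apply: ler_pM; rewrite ?mulr_ge0 ?invr_ge0 ?exprn_ge0 ?normc_ge0 //; last first.
    by rewrite lef_pV2 ?posrE ?normc_1B_ge // (lt_le_trans d0) // normc_1B_ge.
  apply: ler_pM; rewrite ?exprn_ge0 ?normc_ge0 //.
    by rewrite lerXn2r ?nnegrE // ler_nat ltnW.
  by apply: ler_wiXn2l => //; [exact: ltW|rewrite mulnC ltnW // ltn_ceil].
rewrite sumr_const_nat subn1 /= -[leLHS]mulr_natl !mulrA [leRHS]mulrAC.
rewrite ler_wpM2r ?invr_ge0 ?(ltW d0) //.
apply: le_trans (hK N); rewrite exprS ler_wpM2r ?exprn_ge0 // ler_wpM2r ?exprn_ge0 //.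
by rewrite ler_nat.
Qed.

Lemma normc_expC z : normc (expC z) = expR (complex.Re z).
Proof.
rewrite /expC /= !exprMn -mulrDr cos2Dsin2 mulr1 sqrtr_sqr.
by rewrite ger0_norm ?expR_ge0.
Qed.

Lemma normc_nome (tau : R[i]) : 0 < complex.Im tau -> normc (nome tau) < 1.
Proof.
move=> t0; rewrite /nome normc_expC -expR0 ltr_expR.
case: tau t0 => x y /= y0.
have := pi_gt0 R => p0.
rewrite !(mulr0, mul0r, addr0, add0r, subr0, sub0r, mulr1, oppr0) oppr_lt0 expR0 mulr1.
by rewrite !mulr_gt0.
Qed.

Definition majorized (p : {poly R[i]}) (P : {poly R}) := forall n, normc p`_n <= P`_n.

Lemma majorizedM p P p' P' :
  majorized p P -> majorized p' P' -> majorized (p * p') (P * P').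
Proof.
move=> hp hq n; rewrite !coefM; apply: le_trans (normc_sum _ _ _) _.
by apply: ler_sum => i _; rewrite normcM ler_pM ?normc_ge0.
Qed.

Lemma majorized1 : majorized 1 1.
Proof. by move=> n; rewrite !coef1; case: eqP; rewrite ?normc1 ?normc0. Qed.

Lemma majorizedX p P k : majorized p P -> majorized (p ^+ k) (P ^+ k).
Proof.
move=> h; elim: k => [|k IH]; first exact: majorized1.
by rewrite !exprS; exact: majorizedM.
Qed.

Lemma majorized_euler_poly N :
  majorized (euler_poly R[i] N) (\prod_(1 <= r < N.+1) (1 + 'X^r) ^+ 24).
Proof.
rewrite /euler_poly; elim/big_rec2: _ => [|r P p _ IH]; first exact: majorized1.
apply: majorizedM => //; apply: majorizedX => n.
rewrite coefB coefD !coef1 !coefXn; apply: le_trans (le_normcD _ _) _.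
by rewrite normcN; apply: lerD; rewrite normc_nat.
Qed.

Lemma prod_1Dgeo_le (r : R) N : 0 <= r -> r < 1 ->
  \prod_(1 <= i < N.+1) (1 + r ^+ i) ^+ 24 <= expR (1 - r)^-1 ^+ 24.
Proof.
move=> r0 r1; rewrite prodrXl lerXn2r ?nnegrE ?expR_ge0 //.
  by apply: prodr_ge0 => i _; rewrite addr_ge0 ?exprn_ge0.
apply: le_trans (_ : \prod_(1 <= i < N.+1) expR (r ^+ i) <= _).
  by apply: ler_prod => i _; rewrite expR_ge1Dx addr_ge0 ?exprn_ge0.
rewrite -expR_sum ler_expR; apply: le_trans (sum_geo_le _ _ r0 r1) _.
by rewrite expr1 ler_piMl ?invr_ge0 ?subr_ge0 ?(ltW r1).
Qed.

(** Replacing each 1 - X^i by 1 + X^i gives a majorant with nonnegative coefficients. Each of its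
    terms is at most its value at r, which 1 + x <= e^x bounds independently of N. *)
Lemma euler_poly_coef_le (r : R) N n : 0 <= r -> r < 1 ->
  normc (euler_poly R[i] N)`_n * r ^+ n <= expR (1 - r)^-1 ^+ 24.
Proof.
move=> r0 r1; apply: le_trans (prod_1Dgeo_le N r0 r1).
have maj := majorized_euler_poly N; set P := \prod_(_ <= _ < _) _ in maj.
have -> : \prod_(1 <= i < N.+1) (1 + r ^+ i) ^+ 24 = P.[r].
  by rewrite horner_prod; apply: eq_bigr => i _; rewrite !hornerE.
have P0 i : 0 <= P`_i := le_trans (normc_ge0 _) (maj i).
apply: le_trans (_ : P`_n * r ^+ n <= _); first by rewrite ler_wpM2r ?exprn_ge0.
have t0 i : 0 <= P`_i * r ^+ i by rewrite mulr_ge0 ?exprn_ge0.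
have [nP|nP] := ltnP n (size P); last first.
  by rewrite nth_default // mul0r horner_coef sumr_ge0.
by rewrite horner_coef (bigD1 (Ordinal nP)) //= lerDl sumr_ge0.
Qed.

(** The N-th product and the series share their coefficients up to degree N, and a bound uniform in
    N makes the remaining terms negligible. *)
Lemma euler_product q : normc q < 1 -> exists P,
  sums (fun n => euler_coef R[i] n * q ^+ n) P /\
  (fun N => \prod_(1 <= r < N.+1) (1 - q ^+ r) ^+ 24) @ \oo --> P.
Proof.
move=> q1; have q0 := normc_ge0 q.
(* A radius strictly between |q| and 1: the coefficient bound at r becomes K s^n at q, with s =
   |q|/r < 1. *)
pose r := (1 + normc q) / 2; pose s := normc q / r.
have r0 : 0 < r by rewrite /r; lra.
have r1 : r < 1 by rewrite /r; lra.
have s0 : 0 <= s by rewrite divr_ge0 // ltW.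
have s1 : s < 1 by rewrite ltr_pdivrMr // mul1r /r; lra.
pose K := expR (1 - r)^-1 ^+ 24.
have K0 : 0 <= K by rewrite exprn_ge0 ?expR_ge0.
have hK N n : normc ((euler_poly R[i] N)`_n * q ^+ n) <= K * s ^+ n.
  rewrite normcM normcX expr_div_n mulrA ler_pdivlMr ?exprn_gt0 // mulrAC.
  by rewrite ler_wpM2r ?exprn_ge0 // euler_poly_coef_le // ltW.
have [P hP] : exists P, sums (fun n => euler_coef R[i] n * q ^+ n) P.
  by apply: sums_exists; exists K, s; split=> // n; exact: hK.
exists P; split=> //.
set f := (f in f @ _ --> _); pose g N := psum (fun n => euler_coef R[i] n * q ^+ n) N.+1.
have -> : f = (fun N => g N + (f N - g N)) by apply/funext => N; rewrite addrC subrK.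
rewrite -[P]addr0; apply: cvgC_add; first by move: (hP.2); rewrite -cvg_shiftS.
apply: (@cvgC_bound _ _ _ (fun N => K / (1 - s) * s ^+ N)); last exact: cvg_geo0.
move=> N; rewrite subr0.
have -> : f N = (euler_poly R[i] N).[q].
  by rewrite horner_prod; apply: eq_bigr => i _; rewrite !hornerE.
(* Large enough both for the degree of the product and for the cut at N + 1. *)
pose M := maxn N.+1 (size (euler_poly R[i] N)).
rewrite (@horner_coef_wide _ M) ?leq_maxr //.
rewrite -(big_mkord xpredT (fun i => (euler_poly R[i] N)`_i * q ^+ i)).
rewrite (big_cat_nat (n := N.+1)) ?leq_maxl //= big_mkord addrAC -sumrB.
rewrite big1 ?add0r => [|n _]; last first.
  have nN : (n <= N)%N by rewrite -ltnS.
  by rewrite (eq_upto_euler_poly _ nN) // subrr.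
apply: le_trans (normc_sum _ _ _) _.
apply: le_trans (_ : \sum_(N.+1 <= n < M) K * s ^+ n <= _).
  by apply: ler_sum => n _; exact: hK.
rewrite -mulr_sumr -mulrA ler_wpM2l // mulrC; apply: le_trans (sum_geo_le _ _ s0 s1) _.
by rewrite ler_wpM2r ?invr_ge0 ?subr_ge0 ?(ltW s1) // exprS ler_piMl ?exprn_ge0 // ltW.
Qed.

End Analysis.

Lemma conv_exp (A : comPzRingType) (a b : nat -> A) x n :
  conv (fun n => a n * x ^+ n) (fun n => b n * x ^+ n) n = conv a b n * x ^+ n.
Proof.
rewrite /conv mulr_suml; apply: eq_bigr => i _.
have -> : x ^+ n = x ^+ i * x ^+ (n - i) by rewrite -exprD subnKC // -ltnS.
by ring.
Qed.

(** * Uniqueness of coefficients and the Bernoulli recurrence *)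

Section PowerSeries.
Import ComplexField.Normc.
Local Open Scope classical_set_scope.
Variable R : realType.
Implicit Types (z w l : R[i]) (u v a b : nat -> R[i]).

(** If the coefficients before n vanish, then |c_n| t^n is at most the tail, hence at most 2 K (L
    t)^(n+1); dividing by t^n and letting t tend to 0 gives c_n = 0. *)
Lemma power_series_unique (c : nat -> R[i]) (K L t0 : R) :
    0 <= K -> 0 <= L -> 0 < t0 -> (forall n, normc (c n) <= K * L ^+ n) ->
    (forall t : R, 0 < t -> t < t0 ->
       psum (fun n => c n * t%:C%C ^+ n) @ \oo --> (0 : R[i])) ->
  forall n, c n = 0.
Proof.
move=> K0 L0 t00 hc hs; elim/ltn_ind => n IH.
have small (t : R) : 0 < t -> t < t0 -> L * t <= 2^-1 ->
    normc (c n) <= 2 * K * L ^+ n.+1 * t.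
  move=> tp tt0 Lt; have Lt0 : 0 <= L * t by rewrite mulr_ge0 // ltW.
  have tn : 0 < t ^+ n by rewrite exprn_gt0.
  rewrite -(ler_pM2r tn).
  apply: le_trans (_ : K * ((L * t) ^+ n.+1 * 2) <= _); last first.
    by rewrite exprMn [t ^+ n.+1]exprS le_eqVlt; apply/orP; left; apply/eqP; ring.
  apply/ler_addgt0Pl => e e0.
  have [N _ hN] := cvgC_dist (hs t tp tt0) e0.
  pose M := (maxn N n.+1).
  have := hN M (leq_maxl _ _); rewrite /= subr0 => hM.
  have eM : psum (fun k => c k * t%:C%C ^+ k) M =
      c n * t%:C%C ^+ n + \sum_(n.+1 <= k < M) c k * t%:C%C ^+ k.
    rewrite /psum -(big_mkord xpredT (fun k => c k * t%:C%C ^+ k)).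
    rewrite (big_cat_nat (n := n.+1)) ?leq_maxr //= big_nat_recr //=.
    rewrite big_nat_cond big1 ?add0r //.
    by move=> k /andP[/andP[_ kn] _]; rewrite IH // mul0r.
  have -> : normc (c n) * t ^+ n = normc (c n * t%:C%C ^+ n).
    by rewrite normcM normcX normc_real ger0_norm // ltW.
  have -> : c n * t%:C%C ^+ n = psum (fun k => c k * t%:C%C ^+ k) M +
      - \sum_(n.+1 <= k < M) c k * t%:C%C ^+ k by rewrite eM addrK.
  apply: le_trans (le_normcD _ _) _; apply: lerD; first exact: ltW.
  rewrite normcN; apply: le_trans (normc_sum _ _ _) _.
  apply: le_trans (_ : \sum_(n.+1 <= k < M) K * (L * t) ^+ k <= _).
    apply: ler_sum => k _; rewrite normcM normcX normc_real (ger0_norm (ltW tp)).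
    by rewrite exprMn mulrA ler_wpM2r // exprn_ge0 // ltW.
  rewrite -mulr_sumr ler_wpM2l //.
  apply: le_trans (sum_geo_le _ _ Lt0 _) _; first by lra.
  rewrite ler_wpM2l ?exprn_ge0 // -[2]invrK lef_pV2 ?posrE; lra.
apply: eq0_normc; apply/eqP; rewrite eq_le normc_ge0 andbT.
apply/ler_addgt0Pl => e e0; rewrite addr0.
set A := 2 * K * L ^+ n.+1 in small.
have A0 : 0 <= A by rewrite !mulr_ge0 // exprn_ge0.
(* The three bounds ensure t < t0, L t <= 1/2 and A t <= e respectively. *)
pose t := Num.min (t0 / 2) (Num.min (2 * (L + 1))^-1 (e / (A + 1))).
have tp : 0 < t by rewrite !lt_min !divr_gt0 ?invr_gt0 ?mulr_gt0 ?ltr_wpDl.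
have t1 : t <= t0 / 2 by rewrite /t ge_min lexx.
have t2 : t <= (2 * (L + 1))^-1 by rewrite /t !ge_min lexx orbT.
have t3 : t <= e / (A + 1) by rewrite /t !ge_min lexx !orbT.
apply: le_trans (small t tp _ _) _.
- by lra.
- move: t2; rewrite -[X in _ <= X]mul1r ler_pdivlMr; last by lra.
  by move=> t2; nra.
move: t3; rewrite ler_pdivlMr; last by lra.
by move=> t3; nra.
Qed.

Lemma expC_real (t : R) : expC t%:C%C = (expR t)%:C%C.
Proof. by rewrite /expC /= cos0 sin0 mulr1 mulr0. Qed.

(** The equation b(t) (e^t - 1) = t for small real t > 0 is enough to compare coefficients. *)
Lemma bernoulli_rec (B : nat -> R[i]) : bernoulli_numbers B ->
  forall n, \sum_(i < n.+1) B i / i`!%:R / (n.+1 - i)`!%:R = (n == 0)%:R.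
Proof.
move=> hB; pose b n := B n / n`!%:R; pose e n : R[i] := (n`!%:R)^-1.
have hbt (t : R) : 0 < t -> t < 2 ->
    psum (fun n => b n * t%:C%C ^+ n) @ \oo --> t%:C%C / ((expR t)%:C%C - 1).
  move=> t0 t2; rewrite -expC_real.
  have -> : psum (fun n => b n * t%:C%C ^+ n) =
      series (fun n => B n * t%:C%C ^+ n / n`!%:R).
    apply/funext => N; rewrite /psum /series /= big_mkord.
    by apply: eq_bigr => i _; rewrite /b mulrAC.
  apply: hB; first by rewrite fmorph_eq0 gt_eqF.
  by rewrite normC_normc normc_real ltcR gtr0_norm //; have := pi_ge2 R; lra.
(* Convergence at t = 1 bounds b_n: from some rank on it is a difference of two partial sums, each
   within 1 of the limit. *)
have [K [K1 hK]] : exists K : R, 1 <= K /\ forall n, normc (b n) <= K.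
  have /cvgC_dist /(_ _ ltr01) [N _ hN] := hbt 1 ltr01 ltac:(lra).
  exists (2 + \sum_(n < N) normc (b n)); have s0 : 0 <= \sum_(n < N) normc (b n).
    by apply: sumr_ge0 => i _; exact: normc_ge0.
  split=> [|n]; first by lra.
  have [Nn|nN] := leqP N n; last first.
    rewrite (bigD1 (Ordinal nN)) //= addrCA lerDl addr_ge0 // sumr_ge0 // => i _.
    exact: normc_ge0.
  have := hN n Nn; have := hN n.+1 (leqW Nn); rewrite /=.
  set l := _ / _; set S := psum _ => h1 h2.
  have -> : b n = (S n.+1 - l) + - (S n - l).
    rewrite /S /psum big_ord_recr /= expr1n mulr1; ring.
  by have := le_normcD (S n.+1 - l) (- (S n - l)); rewrite normcN; lra.
have he n : normc (e n) <= 1.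
  rewrite /e normcV normc_nat invf_le1 ?ltr0n ?fact_gt0 //.
  by rewrite ler1n fact_gt0.
(* the coefficients of b(t) e^t = b(t) + t *)
have rb n : conv b e n - b n - (n == 1)%:R = 0.
  move: n; apply: (@power_series_unique _ (K ^+ 2 + K + 1) 2 (2^-1)) => //; first by nra.
    (* The convolution is at most K^2 (n + 1) <= K^2 2^n, whence the ratio 2; the other two terms
       contribute K and 1. *)
    move=> n; apply: le_trans (le_normcD _ _) _; rewrite normcN normc_nat.
    apply: le_trans (lerD (le_normcD _ _) (lexx _)) _; rewrite normcN.
    have p1 : 1 <= 2 ^+ n :> R by rewrite exprn_ege1 //; lra.
    rewrite !mulrDl; apply: lerD; last by rewrite mul1r; apply: le_trans p1; case: (n == 1).
    apply: lerD; last by apply: le_trans (hK n) _; rewrite ler_peMr //; lra.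
    apply: le_trans (@normc_conv _ b e K 1 n _ _ _ _) _ => //; try lra.
    - by move=> k; rewrite expr1n mulr1.
    - by move=> k; rewrite expr1n mulr1; apply: le_trans (he k) _.
    rewrite expr1n mulr1 ler_wpM2l //; first by rewrite exprn_ge0 //; lra.
    by rewrite -natrX ler_nat ltn_expl.
  move=> t t0 t2.
  have geo f : (forall n, normc (f n) <= K) -> geo_bounded (fun n => f n * t%:C%C ^+ n).
    move=> hf; exists K, t; split; try lra.
    move=> n; rewrite normcM normcX normc_real (ger0_norm (ltW t0)).
    by rewrite ler_wpM2r // exprn_ge0 // ltW.
  have sb : sums (fun n => b n * t%:C%C ^+ n) (t%:C%C / ((expR t)%:C%C - 1)).
    by split; [exact: geo | apply: hbt => //; lra].
  have se : sums (fun n => e n * t%:C%C ^+ n) (expR t)%:C%C.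
    split; first by apply: geo => n; exact: le_trans (he n) K1.
    have -> : psum (fun n => e n * t%:C%C ^+ n) = (fun N => (series (exp_coeff t) N)%:C%C).
      apply/funext => N; rewrite /psum /series /= big_mkord rmorph_sum; apply: eq_bigr => i _.
      by rewrite rmorphM fmorphV rmorph_nat rmorphXn mulrC.
    apply: (@cvgC_bound _ _ _ (fun N => `|series (exp_coeff t) N - expR t|)).
      by move=> N; rewrite -rmorphB normc_real.
    rewrite -(normr0 R); apply: cvg_norm; apply/subr_cvg0.
    exact: is_cvg_series_exp_coeff.
  have nz : (expR t)%:C%C - 1 != 0 :> R[i].
    have -> : (expR t)%:C%C - 1 = (expR t - 1)%:C%C :> R[i] by rewrite rmorphB rmorph1.
    by rewrite fmorph_eq0 subr_eq0 gt_eqF // expR_gt1.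
  have s1 := sumsD (sums_conv sb se) (sumsZ (-1) sb).
  have /(sumsZ (-1)) s2 : sums (fun n => (n == 1)%:R * t%:C%C ^+ n) t%:C%C.
    have := @sums_finite R (fun n => (n == 1)%:R * t%:C%C ^+ n) 2.
    rewrite [psum _ 2]/psum !big_ord_recl big_ord0 /= mul0r mul1r add0r addr0 expr1; apply.
    by move=> [|[|n]] // _; rewrite mul0r.
  have := (sumsD s1 s2).2.
  have -> : (fun n => conv (fun n => b n * t%:C%C ^+ n) (fun n => e n * t%:C%C ^+ n) n +
      -1 * (b n * t%:C%C ^+ n) + -1 * ((n == 1)%:R * t%:C%C ^+ n)) =
      (fun n => (conv b e n - b n - (n == 1)%:R) * t%:C%C ^+ n).
    by apply/funext => n; rewrite conv_exp; ring.
  set x := _ + -1 * t%:C%C; suff -> : x = 0 by [].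
  by rewrite /x; field.
(* At index n + 1 the last term of the convolution is b_(n+1) itself and cancels. *)
move=> n; have := rb n.+1; rewrite /conv big_ord_recr /= subnn /e fact0 invr1 mulr1.
rewrite addrK => /eqP; rewrite subr_eq0 => /eqP; rewrite eqSS => <-.
by apply: eq_bigr.
Qed.
End PowerSeries.

(** * Eisenstein series *)

Section EisensteinAlgebra.
Variable F : numFieldType.

(** The unknown s heads the right side of a relation. It suffices that the proposed value v
    satisfies the same equation; [k] is the inverse of the leading coefficient. *)
Lemma solve_head (h s v r l : F) k :
  k * h = 1 -> l = h * s + r -> l = h * v + r -> s = v.
Proof.
move=> kh e; rewrite {}e => /addIr e.
by rewrite -[s]mul1r -[v]mul1r -kh -!mulrA e.
Qed.

(** [S k] stands for sum_n sigma_k(n) q^n. Each formula is E_2n = 1 - (4n / B_2n) [S (2n - 1)]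
    solved for [S]. As every E_2n has constant term 1, the coefficients of its polynomial add up to
    the divisor: 441 + 250 = 691. *)
Lemma eisenstein_S (S : nat -> F) (x y : F) :
    (forall (O : seq (F * (nat * nat))) (H : seq (F * nat)),
      (forall n, \sum_(t <- O) t.1 * conv (sigma F t.2.1) (sigma F t.2.2) n =
                 \sum_(t <- H) t.1 * sigma F t.2 n) ->
      \sum_(t <- O) t.1 * (S t.2.1 * S t.2.2) = \sum_(t <- H) t.1 * S t.2) ->
    x = 1 + 240 * S 3 -> y = 1 - 504 * S 5 ->
  S 7 = (x ^+ 2 - 1) / 480 /\
  S 9 = (1 - x * y) / 264 /\
  S 11 = ((441 * x ^+ 3 + 250 * y ^+ 2) / 691 - 1) / (65520%:R / 691) /\
  S 13 = (1 - x ^+ 2 * y) / 24 /\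
  S 15 = ((1617 * x ^+ 4 + 2000 * x * y ^+ 2) / 3617 - 1) / (16320%:R / 3617) /\
  S 17 = (1 - (38367%:R * x ^+ 3 * y + 5500%:R * y ^+ 3) / 43867%:R)
           / (28728%:R / 43867%:R) /\
  S 19 = ((53361%:R * x ^+ 5 + 121250%:R * x ^+ 2 * y ^+ 2) / 174611%:R - 1)
           / (13200%:R / 174611%:R) /\
  S 21 = (1 - (57183%:R * x ^+ 4 * y + 20500%:R * x * y ^+ 3) / 77683%:R)
           / (552 / 77683%:R).
Proof.
move=> rel ex ey.
have s3 : S 3 = (x - 1) / 240 by rewrite ex; field.
have s5 : S 5 = (1 - y) / 504 by rewrite ey; field.
(* Each conjunct becomes available for the next ones, whose relations involve the earlier sums. *)
have and_dep (P Q : Prop) : P -> (P -> Q) -> P /\ Q by tauto.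
have := rel _ _ (conv_sigma_weight8 F).
rewrite !big_cons !big_nil; cbn [fst snd] => w7.
apply: (and_dep _ _) => [|s7].
  by apply: (solve_head (k := 30) _ w7); rewrite ?s3 ?s5; field.
have := rel _ _ (conv_sigma_weight10 F).
rewrite !big_cons !big_nil; cbn [fst snd] => w9.
apply: (and_dep _ _) => [|s9].
  by apply: (solve_head (k := 420 / 11) _ w9); rewrite ?s3 ?s5 ?s7; field.
have := rel _ _ (conv_sigma_weight12 F).
rewrite !big_cons !big_nil; cbn [fst snd] => w11.
apply: (and_dep _ _) => [|s11].
  by apply: (solve_head (k := 630 / 13) _ w11); rewrite ?s3 ?s5 ?s7 ?s9; field.
have := rel _ _ (conv_sigma_weight14 F).
rewrite !big_cons !big_nil; cbn [fst snd] => w13.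
apply: (and_dep _ _) => [|s13].
  by apply: (solve_head (k := 6930%:R / 113) _ w13); rewrite ?s3 ?s5 ?s7 ?s9 ?s11; field.
have := rel _ _ (conv_sigma_weight16 F).
rewrite !big_cons !big_nil; cbn [fst snd] => w15.
apply: (and_dep _ _) => [|s15].
  by apply: (solve_head (k := 180180%:R / 2329) _ w15);
    rewrite ?s3 ?s5 ?s7 ?s9 ?s11 ?s13; field.
have := rel _ _ (conv_sigma_weight18 F).
rewrite !big_cons !big_nil; cbn [fst snd] => w17.
apply: (and_dep _ _) => [|s17].
  by apply: (solve_head (k := 1848 / 19) _ w17);
    rewrite ?s3 ?s5 ?s7 ?s9 ?s11 ?s13 ?s15; field.
have := rel _ _ (conv_sigma_weight20 F).
rewrite !big_cons !big_nil; cbn [fst snd] => w19.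
apply: (and_dep _ _) => [|s19].
  by apply: (solve_head (k := 51051%:R / 419) _ w19);
    rewrite ?s3 ?s5 ?s7 ?s9 ?s11 ?s13 ?s15 ?s17; field.
have := rel _ _ (conv_sigma_weight22 F).
rewrite !big_cons !big_nil; cbn [fst snd] => w21.
by apply: (solve_head (k := 1108536%:R / 7291%:R) _ w21);
  rewrite ?s3 ?s5 ?s7 ?s9 ?s11 ?s13 ?s15 ?s17 ?s19; field.
Qed.

End EisensteinAlgebra.

(** * Eisenstein series and the discriminant at the nome *)

Section Eisenstein.
Import ComplexField.Normc.
Local Open Scope classical_set_scope.
Variable R : realType.
Implicit Types (q : R[i]) (S : nat -> R[i]).

Lemma sums_conv_exp (a b : nat -> R[i]) q l m :
  sums (fun n => a n * q ^+ n) l -> sums (fun n => b n * q ^+ n) m ->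
  sums (fun n => conv a b n * q ^+ n) (l * m).
Proof.
by move=> ha hb; apply: eq_sums (sums_conv ha hb) => n; rewrite conv_exp.
Qed.

Lemma sums_delta q k : sums (fun n => (n == k)%:R * q ^+ n) (q ^+ k).
Proof.
have := @sums_finite R (fun n => (n == k)%:R * q ^+ n) k.+1.
rewrite [psum _ _]/psum big_ord_recr /= eqxx mul1r big1 ?add0r => [|i _].
  by apply=> n kn; rewrite gtn_eqF // mul0r.
by rewrite ltn_eqF ?ltn_ord // mul0r.
Qed.

Lemma sums_eis q c k s : sums (fun n => sigma R[i] k n * q ^+ n) s ->
  sums (fun n => eis c k n * q ^+ n) (1 + c * s).
Proof.
move=> hs; have := sumsD (sums_delta q 0) (sumsZ c hs); rewrite expr0.
by apply: eq_sums => n; rewrite /eis mulrDl mulrA.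
Qed.

Lemma sums_relation q S : (forall k, sums (fun n => sigma R[i] k n * q ^+ n) (S k)) ->
  forall (O : seq (R[i] * (nat * nat))) (H : seq (R[i] * nat)),
    (forall n, \sum_(t <- O) t.1 * conv (sigma R[i] t.2.1) (sigma R[i] t.2.2) n =
               \sum_(t <- H) t.1 * sigma R[i] t.2 n) ->
  \sum_(t <- O) t.1 * (S t.2.1 * S t.2.2) = \sum_(t <- H) t.1 * S t.2.
Proof.
move=> hS O H e.
have sum0 : sums (fun _ => 0) (0 : R[i]).
  have := sumsZ 0 (sums_delta q 0); rewrite mul0r.
  by apply: eq_sums => n; rewrite mul0r.
have hO : sums (fun n => (\sum_(t <- O)
      t.1 * conv (sigma R[i] t.2.1) (sigma R[i] t.2.2) n) * q ^+ n)
   (\sum_(t <- O) t.1 * (S t.2.1 * S t.2.2)).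
  elim: O {e} => [|t O IH].
    by rewrite big_nil; apply: eq_sums sum0 => n; rewrite big_nil mul0r.
  have ht := sumsZ t.1 (sums_conv_exp (hS t.2.1) (hS t.2.2)).
  rewrite big_cons; apply: eq_sums (sumsD ht IH).
  by move=> n; rewrite big_cons mulrDl mulrA.
have hH : sums (fun n => (\sum_(t <- H) t.1 * sigma R[i] t.2 n) * q ^+ n)
   (\sum_(t <- H) t.1 * S t.2).
  elim: H {e} => [|t H IH].
    by rewrite big_nil; apply: eq_sums sum0 => n; rewrite big_nil mul0r.
  rewrite big_cons; apply: eq_sums (sumsD (sumsZ t.1 (hS t.2)) IH).
  by move=> n; rewrite big_cons mulrDl mulrA.
by apply: sums_unique hO _; apply: eq_sums hH => n; rewrite e.
Qed.

Lemma eisensteinE (B : nat -> R[i]) q S n : normc q < 1 ->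
    (forall k, sums (fun n => sigma R[i] k n * q ^+ n) (S k)) ->
  eisenstein B q n = 1 - (4 * n)%:R / B (2 * n)%N * S (2 * n - 1)%N.
Proof.
move=> q1 hS; rewrite /eisenstein; congr (1 - _ * _).
have h := lambert_cvg q1 (hS (2 * n - 1)%N).
exact: (cvgC_unique (cvgP _ h) h).
Qed.

Lemma discriminant_eisenstein (tau : R[i]) S (q := nome tau) : normc q < 1 ->
    (forall k, sums (fun n => sigma R[i] k n * q ^+ n) (S k)) ->
  modular_discriminant tau =
    ((1 + 240 * S 3%N) ^+ 3 - (1 - 504 * S 5%N) ^+ 2) / 1728.
Proof.
move=> q1 hS; have [P [hP cP]] := euler_product q1.
have -> : modular_discriminant tau = q * P.
  rewrite /modular_discriminant -/q; congr (_ * _).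
  exact: (cvgC_unique (cvgP _ cP) cP).
have h4 := sums_eis 240 (hS 3%N); have h6 := sums_eis (- 504) (hS 5%N).
have hL := sumsD (sums_conv_exp (sums_conv_exp h4 h4) h4) (sumsZ (-1) (sums_conv_exp h6 h6)).
have hR := sumsZ 1728 (sums_conv_exp (sums_delta q 1) hP).
have e : 1728 * (q * P) = (1 + 240 * S 3%N) ^+ 3 - (1 - 504 * S 5%N) ^+ 2.
  have := sums_unique hR (eq_sums _ hL); rewrite expr1 => ->; first by ring.
  move=> n; rewrite mulN1r -mulrBl.
  rewrite [LHS](congr1 (fun z => z * q ^+ n) (discriminant_coef R[i] n)).
  (* Convolution with the coefficients of q shifts those of the product by one, as in
     [discriminant_coef]. *)
  rewrite -mulrA; congr (_ * (_ * _)); rewrite /conv big_ord_recl mul0r add0r.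
  case: n => [|n]; first by rewrite big_ord0.
  rewrite big_ord_recl /= mul1r /bump /= add1n subSS subn0 big1 ?addr0 // => i _.
  by rewrite mul0r.
by rewrite -e [RHS]mulrC mulKf ?pnatr_eq0.
Qed.
(** Hiding the series behind two unknowns x and y leaves pure polynomial algebra for the
    determinants. *)
Lemma eisenstein_ring (B : nat -> R[i]) (tau : R[i])
    (E := fun k => eisenstein B (nome tau) k./2) :
    bernoulli_numbers B -> 0 < complex.Im tau ->
  exists x y : R[i],
  modular_discriminant tau = (x ^+ 3 - y ^+ 2) / 1728 /\
  E 4%N = x /\
  E 6%N = y /\
  E 8%N = x ^+ 2 /\
  E 10%N = x * y /\
  E 12%N = (441 * x ^+ 3 + 250 * y ^+ 2) / 691 /\
  E 14%N = x ^+ 2 * y /\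
  E 16%N = (1617 * x ^+ 4 + 2000 * x * y ^+ 2) / 3617 /\
  E 18%N = (38367%:R * x ^+ 3 * y + 5500%:R * y ^+ 3) / 43867%:R /\
  E 20%N = (53361%:R * x ^+ 5 + 121250%:R * x ^+ 2 * y ^+ 2) / 174611%:R /\
  E 22%N = (57183%:R * x ^+ 4 * y + 20500%:R * x * y ^+ 3) / 77683%:R.
Proof.
move=> hB htau; pose q := nome tau.
have q1 : normc q < 1 := normc_nome htau.
have [S hS] := boolp.choice (fun k => sums_exists (geo_bounded_sigma k q1)).
have hE n : eisenstein B q n = _ := eisensteinE B n q1 hS.
have hB' := bernoulli_values (bernoulli_rec hB).
pose x := 1 + 240 * S 3%N; pose y := 1 - 504 * S 5%N.
have [s7 [s9 [s11 [s13 [s15 [s17 [s19 s21]]]]]]] :=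
  eisenstein_S (x := x) (y := y) (sums_relation hS) erefl erefl.
have b4 : B 4%N = - 1 / 30 := hB' 4%N isT.
have e4 : E 4%N = x.
  have -> : E 4%N = 1 - 8 / B 4%N * S 3%N := hE 2%N.
  by rewrite b4 /x; field.
have b6 : B 6%N = 1 / 42 := hB' 6%N isT.
have e6 : E 6%N = y.
  have -> : E 6%N = 1 - 12 / B 6%N * S 5%N := hE 3%N.
  by rewrite b6 /y; field.
have b8 : B 8%N = - 1 / 30 := hB' 8%N isT.
have e8 : E 8%N = x ^+ 2.
  have -> : E 8%N = 1 - 16 / B 8%N * S 7%N := hE 4%N.
  by rewrite b8 s7; field.
have b10 : B 10%N = 5 / 66 := hB' 10%N isT.
have e10 : E 10%N = x * y.
  have -> : E 10%N = 1 - 20 / B 10%N * S 9%N := hE 5%N.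
  by rewrite b10 s9; field.
have b12 : B 12%N = - 691 / 2730 := hB' 12%N isT.
have e12 : E 12%N = (441 * x ^+ 3 + 250 * y ^+ 2) / 691.
  have -> : E 12%N = 1 - 24 / B 12%N * S 11%N := hE 6%N.
  by rewrite b12 s11; field.
have b14 : B 14%N = 7 / 6 := hB' 14%N isT.
have e14 : E 14%N = x ^+ 2 * y.
  have -> : E 14%N = 1 - 28 / B 14%N * S 13%N := hE 7%N.
  by rewrite b14 s13; field.
have b16 : B 16%N = - 3617 / 510 := hB' 16%N isT.
have e16 : E 16%N = (1617 * x ^+ 4 + 2000 * x * y ^+ 2) / 3617.
  have -> : E 16%N = 1 - 32 / B 16%N * S 15%N := hE 8%N.
  by rewrite b16 s15; field.
have b18 : B 18%N = 43867%:R / 798 := hB' 18%N isT.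
have e18 : E 18%N = (38367%:R * x ^+ 3 * y + 5500%:R * y ^+ 3) / 43867%:R.
  have -> : E 18%N = 1 - 36 / B 18%N * S 17%N := hE 9%N.
  by rewrite b18 s17; field.
have b20 : B 20%N = - 174611%:R / 330 := hB' 20%N isT.
have e20 : E 20%N = (53361%:R * x ^+ 5 + 121250%:R * x ^+ 2 * y ^+ 2) / 174611%:R.
  have -> : E 20%N = 1 - 40 / B 20%N * S 19%N := hE 10%N.
  by rewrite b20 s19; field.
(* As 854513 = 11 * 77683, the factor 44 / B_22 is 552 / 77683. *)
have b22 : B 22%N = 854513%:R / 138 := hB' 22%N isT.
have e22 : E 22%N = (57183%:R * x ^+ 4 * y + 20500%:R * x * y ^+ 3) / 77683%:R.
  have -> : E 22%N = 1 - 44 / B 22%N * S 21%N := hE 11%N.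
  by rewrite b22 s21; field.
exists x, y; split; first exact: discriminant_eisenstein q1 hS.
exact: (conj e4 (conj e6 (conj e8 (conj e10 (conj e12 (conj e14 (conj e16
  (conj e18 (conj e20 e22))))))))).
Qed.

End Eisenstein.

(** Only the expansion and the list operations are evaluated; ring operations and numerals stay
    folded for [field]. *)
Local Ltac det_identity E D detE es := match goal with |- context [D ?s] =>
  let t := eval cbn [laplace alternating_sum size map drop_nth take drop
                     behead head cat negb] in (laplace E (size s) s) in
  rewrite (detE s isT : D s = t) !es; field end.

Theorem theorem2p3 (R : realType) (B : nat -> R[i]) (tau : R[i])
    (hB : bernoulli_numbers B) (htau : 0 < complex.Im tau) :
  let q := nome tau in
  let Delta := modular_discriminant tau in
  let E (k : nat) := eisenstein B q k./2 in
  let D := index_det E in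
  (E 4%N * Delta
     = - (691 / (1728 * 250)) * D [:: [:: 4; 8]; [:: 8; 12]]%N) /\
  (E 6%N * Delta
     = 691 / (1728 * 250) * D [:: [:: 4; 12]; [:: 6; 14]]%N) /\
  (E 8%N * Delta
     = 3617 / (1728 * 3 * 7 ^+ 2 * 11) * D [:: [:: 4; 10]; [:: 10; 16]]%N) /\
  (E 8%N * Delta
     = 691 / (1728 * 441) * D [:: [:: 8; 10]; [:: 10; 12]]%N) /\
  (E 10%N * Delta
     = 691 * 43867%:R / (1728 * 2 * 3 ^+ 2 * 5 ^+ 4 * 7 ^+ 2 * 13) *
       D [:: [:: 4; 12]; [:: 10; 18]]%N) /\
  (E 10%N * Delta
     = 691 / (1728 * 250) * D [:: [:: 8; 12]; [:: 10; 14]]%N) /\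
  (E 14%N * Delta
     = 691 * 593 * 131 / (1728 * 2 * 3 * 5 ^+ 3 * 7 ^+ 2 * 11 * 13) *
       D [:: [:: 4; 14]; [:: 12; 22]]%N) /\
  (E 14%N * Delta
     = - (691 * 3617 / (1728 * 2 * 3 * 5 ^+ 3 * 7 ^+ 2 * 13)) *
       D [:: [:: 10; 14]; [:: 12; 16]]%N) /\
  (E 4%N * Delta ^+ 2
     = 691 ^+ 2 / (1728 ^+ 2 * 21 ^+ 2 * 250) *
       D [:: [:: 4; 8; 10]; [:: 6; 10; 12]; [:: 8; 12; 14]]%N) /\
  (E 6%N * Delta ^+ 2
     = - (691 ^+ 2 / (1728 ^+ 2 * 250 ^+ 2)) *
       D [:: [:: 6; 8; 10]; [:: 8; 10; 12]; [:: 10; 12; 14]]%N) /\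
  (E 8%N * Delta ^+ 2
     = - (691 ^+ 2 * 3617 /
          (1728 ^+ 2 * 2 ^+ 3 * 3 * 5 ^+ 3 * 7 ^+ 2 * 467)) *
       D [:: [:: 6; 8; 12]; [:: 8; 10; 14]; [:: 10; 12; 16]]%N) /\
  (E 10%N * Delta ^+ 2
     = 691 ^+ 2 * 3617 /
         (1728 ^+ 2 * 2 ^+ 2 * 3 * 5 ^+ 6 * 7 ^+ 2 * 13) *
       D [:: [:: 6; 10; 12]; [:: 8; 12; 14]; [:: 10; 14; 16]]%N) /\
  (E 14%N * Delta ^+ 2
     = - (691 ^+ 2 * 3617 * 43867%:R /
          (1728 ^+ 2 * 2 ^+ 6 * 3 * 5 ^+ 3 * 7 ^+ 2 * 97 * 7213%:R)) *
       D [:: [:: 8; 10; 14]; [:: 10; 12; 16]; [:: 12; 14; 18]]%N) /\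
  (E 4%N * Delta ^+ 3
     = - (691 ^+ 3 * 3617 /
          (1728 ^+ 3 * 2 ^+ 4 * 3 * 5 ^+ 6 * 7 ^+ 2 * 467)) *
       D [:: [:: 4; 6; 8; 10]; [:: 6; 8; 10; 12];
             [:: 8; 10; 12; 14]; [:: 10; 12; 14; 16]]%N) /\
  (E 6%N * Delta ^+ 3
     = - (691 ^+ 3 * 43867%:R /
          (1728 ^+ 3 * 2 ^+ 5 * 3 ^+ 2 * 5 ^+ 6 * 7 ^+ 2 * 131)) *
       D [:: [:: 4; 6; 8; 12]; [:: 6; 8; 10; 14];
             [:: 8; 10; 12; 16]; [:: 10; 12; 14; 18]]%N) /\
  (E 8%N * Delta ^+ 3
     = 691 ^+ 3 * 3617 ^+ 2 /
         (1728 ^+ 3 * 2 ^+ 4 * 3 ^+ 2 * 5 ^+ 6 * 7 ^+ 4 * 13 * 467) *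
       D [:: [:: 4; 6; 10; 12]; [:: 6; 8; 12; 14];
             [:: 8; 10; 14; 16]; [:: 10; 12; 16; 18]]%N) /\
  (E 10%N * Delta ^+ 3
     = - (691 ^+ 3 * 3617 * 43867%:R /
          (1728 ^+ 3 * 2 ^+ 7 * 3 * 5 ^+ 6 * 7 ^+ 2 * 97 * 7213%:R)) *
       D [:: [:: 4; 8; 10; 12]; [:: 6; 10; 12; 14];
             [:: 8; 12; 14; 16]; [:: 10; 14; 16; 18]]%N) /\
  (E 14%N * Delta ^+ 3
     = 691 ^+ 3 * 3617 ^+ 2 * 43867%:R * 283 * 617 /
         (1728 ^+ 4 * 2 ^+ 3 * 3 ^+ 2 * 5 ^+ 6 * 7 ^+ 2 * 31 * 3503110621%:R) *
       D [:: [:: 6; 8; 10; 14]; [:: 8; 10; 12; 16];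
             [:: 10; 12; 14; 18]; [:: 12; 14; 16; 20]]%N) /\
  (E 14%N * Delta ^+ 4
     = 691 ^+ 4 * 3617 ^+ 2 * 43867%:R * 131 * 283 * 593 * 617 /
         (1728 ^+ 6 * 5 ^+ 9 * 7 ^+ 5 * 11 * 13 * 67 * 257 * 43721%:R) *
       D [:: [:: 4; 6; 8; 10; 14]; [:: 6; 8; 10; 12; 16];
             [:: 8; 10; 12; 14; 18]; [:: 10; 12; 14; 16; 20];
             [:: 12; 14; 16; 18; 22]]%N).
Proof.
move=> q Delta E D.
have [x [y [eD [e4 [e6 [e8 [e10 [e12 [e14 [e16 [e18 [e20 e22]]]]]]]]]]]] :=
  eisenstein_ring hB htau.
have detE s : all (fun r => size r == size s) s -> D s = laplace E (size s) s.
  exact: table_detE.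
have es := (eD : Delta = _, e4 : E 4%N = _, e6 : E 6%N = _, e8 : E 8%N = _,
  e10 : E 10%N = _, e12 : E 12%N = _, e14 : E 14%N = _, e16 : E 16%N = _,
  e18 : E 18%N = _, e20 : E 20%N = _, e22 : E 22%N = _).
(* Without their bodies [D], [E] and [Delta] are opaque, and rewriting with [es] leaves an identity
   in x and y alone. *)
clear eD e4 e6 e8 e10 e12 e14 e16 e18 e20 e22; clearbody D E Delta.
by repeat match goal with |- _ /\ _ => split end; det_identity E D detE es.
Qed.
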